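(* Let $H$ be a countable group. Then $H$ has a computable left- (respectively bi-) order if and only if $H$ is (isomorphic to) a subgroup of a finitely generated group $G$ with a computable left- (respectively bi-) order such that the membership problem for the subgroup $H$ in $G$ is decidable. The same equivalence holds with ''subgroup'' replaced by ''subnormal subgroup''. Moreover, for any fixed computable left- (respectively bi-) order on $H$, the group $G$ and its computable left- (respectively bi-) order can be chosen so that the order on $G$ continues the given order on $H$.
   Context: A left-order on a group is a linear order invariant under left multiplication; a bi-order is a linear order invariant under left and right multiplication. For a group with a countable enumerated generating set $X=\{x_1,x_2,\ldots\}$ (finite or infinite), $(X\cup X^{-1})^*$ is the set of finite words in the formal letters $x_i^{\pm1}$; recursiveness is understood via the indices of the letters. An order $\preceq$ on the group is computable with respect to $X$ if $\{(u,v)\in (X\cup X^{-1})^*\times (X\cup X^{-1})^*\mid u\preceq v\}$ is recursive (words identified with the elements they represent). A countable group has a computable left- (bi-) order if it has a left- (bi-) order which is computable with respect to some such generating set; for the finitely generated group $G$ computability of the order is with respect to a finite generating set $S$. The membership problem for $H\le G$ is decidable if there is an algorithm deciding, for a word over $S\cup S^{-1}$, whether the element of $G$ it represents lies in $H$. The order on $G$ continues the order on $H$ if its restriction to the subgroup $H$ is the given order on $H$. *)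

(* Defs.v *)
From HB Require Import structures.
From mathcomp Require Import all_boot.

Set Implicit Arguments.
Unset Strict Implicit.
Unset Printing Implicit Defensive.

Local Open Scope nat_scope.

(* The total recursive functions of n variables: the least class of functions
   containing zero, successor and the projections, and closed under composition,
   primitive recursion, and minimization of regular functions (those for which
   the search always terminates). *)
Inductive recursive : forall n : nat, (n.-tuple nat -> nat) -> Prop :=
| rec_zero n : recursive (fun _ : n.-tuple nat => 0)
| rec_succ : recursive (fun v : 1.-tuple nat => (tnth v ord0).+1)
| rec_proj n (i : 'I_n) : recursive (fun v : n.-tuple nat => tnth v i)
| rec_comp m n (f : m.-tuple nat -> nat) (g : 'I_m -> n.-tuple nat -> nat)
    (h : n.-tuple nat -> nat) :
    recursive f -> (forall i, recursive (g i)) ->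
    (forall v, h v = f [tuple g i v | i < m]) -> recursive h
| rec_prim n (f : n.-tuple nat -> nat) (g : n.+2.-tuple nat -> nat)
    (h : n.+1.-tuple nat -> nat) :
    recursive f -> recursive g ->
    (forall v : n.-tuple nat, h [tuple of 0 :: v] = f v) ->
    (forall k (v : n.-tuple nat), h [tuple of k.+1 :: v]
       = g [tuple of [:: k, h [tuple of k :: v] & v]]) -> recursive h
| rec_min n (f : n.+1.-tuple nat -> nat) (h : n.-tuple nat -> nat) :
    recursive f ->
    (forall v : n.-tuple nat, f [tuple of h v :: v] = 0) ->
    (forall (v : n.-tuple nat) k, k < h v -> f [tuple of k :: v] <> 0) ->
    recursive h.

Local Open Scope group_scope.

(* The pair (i, b) is the formal letter x_i if b = false, x_i^-1 if b = true. *)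
Definition word (I : Type) : Type := seq (I * bool).

Definition word_value (G : groupType) (I : Type) (x : I -> G) (w : word I) : G :=
  \prod_(l <- w) (if l.2 then (x l.1)^-1 else x l.1).

Definition generates (G : groupType) (I : Type) (x : I -> G) : Prop :=
  forall g, exists w : word I, word_value x w = g.

(* Goedel number of a word, where idx numbers the letters; it is injective as
   soon as idx is, CodeSeq.code being a bijection from seq nat to nat. *)
Definition word_code (I : Type) (idx : I -> nat) (w : word I) : nat :=
  CodeSeq.code [seq ((idx l.1).*2 + nat_of_bool l.2)%N | l : I * bool <- w].

Definition recursive_words (I : Type) (idx : I -> nat)
    (P : word I -> Prop) : Prop :=
  exists2 f : 1.-tuple nat -> nat, recursive f &
    forall w, P w <-> f [tuple word_code idx w] = 1%N.

Definition recursive_word_pairs (I : Type) (idx : I -> nat)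
    (P : word I -> word I -> Prop) : Prop :=
  exists2 f : 2.-tuple nat -> nat, recursive f &
    forall u v, P u v <-> f [tuple word_code idx u; word_code idx v] = 1%N.

Definition linear_order (T : Type) (le : rel T) : Prop :=
  [/\ reflexive le, antisymmetric le, transitive le & total le].

Definition left_order (G : groupType) (le : rel G) : Prop :=
  linear_order le /\ forall a x y : G, le x y -> le (a * x) (a * y).

Definition bi_order (G : groupType) (le : rel G) : Prop :=
  left_order le /\ forall a x y : G, le x y -> le (x * a) (y * a).

Variant order_kind := LeftOrder | BiOrder.

Definition is_order (k : order_kind) (G : groupType) (le : rel G) : Prop :=
  match k with LeftOrder => left_order le | BiOrder => bi_order le end.

Definition computable_wrt (G : groupType) (I : Type) (idx : I -> nat)
    (x : I -> G) (le : rel G) : Prop :=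
  recursive_word_pairs idx (fun u v => le (word_value x u) (word_value x v)).

(* The generating set is enumerated, possibly with repetitions, by 'I_n or by
   nat; a letter is numbered by its index. *)
Definition computable_order (k : order_kind) (G : groupType) (le : rel G) : Prop :=
  is_order k le /\
  ((exists n (x : 'I_n -> G),
      generates x /\ computable_wrt (@nat_of_ord n) x le) \/
   (exists x : nat -> G, generates x /\ computable_wrt id x le)).

Definition has_computable_order (k : order_kind) (G : groupType) : Prop :=
  exists le : rel G, computable_order k le.

Definition in_image (H G : groupType) (phi : H -> G) (g : G) : Prop :=
  exists h, phi h = g.

Definition subgroup (G : groupType) (K : G -> Prop) : Prop :=
  [/\ K 1, forall x y, K x -> K y -> K (x * y) & forall x, K x -> K x^-1].

Definition normal_in (G : groupType) (K L : G -> Prop) : Prop :=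
  (forall x, K x -> L x) /\ forall x y, K x -> L y -> K (x ^ y).

Definition subnormal (G : groupType) (K : G -> Prop) : Prop :=
  exists (m : nat) (C : nat -> G -> Prop),
    [/\ forall g, C 0%N g <-> K g,
        forall g, C m g,
        forall i, (i <= m)%N -> subgroup (C i)
      & forall i, (i < m)%N -> normal_in (C i) (C i.+1)].

(* G is generated by a finite family s for which the order leG is computable
   and membership in the copy phi(H) of H is decidable. *)
Definition computable_overgroup (k : order_kind) (H G : groupType)
    (phi : {multiplicative H -> G}) (leG : rel G) : Prop :=
  [/\ injective phi, is_order k leG &
      exists n (s : 'I_n -> G),
        [/\ generates s, computable_wrt (@nat_of_ord n) s leG &
            recursive_words (@nat_of_ord n)
              (fun w => in_image phi (word_value s w))]].

(* Main.v *)
From HB Require Import structures.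
Require Import Defs.
From mathcomp Require Import all_boot all_order ssralg ssrnum ssrint zify.
From mathcomp Require Import boolp.

(** Suppose first that [H] is contained in [G], generated by a finite family [s],
    and that membership in [H] is decidable. Every number codes a word over [s],
    and the words accepted by the membership test enumerate the elements of [H].
    A word in this enumeration unfolds to a word over [s], so the restriction to
    [H] of the order of [G] is computable ([restricted_computable_order]).

    Conversely let [H] have a computable order with respect to [x 0], [x 1], ...
    (for a finite family take [G = H]). The group [G] is a three-generator
    subgroup of an iterated wreath product with the integers. The elements of
    [wreath A] are pairs of a function from the integers to [A], trivial far to
    the left, and a translation. Such a function has a first nontrivial
    coordinate as soon as it is nontrivial, so a left- or bi-order of [A] extends
    lexicographically to one of the same kind on [wreath A]
    ([wreath_cone_is_cone]).

    In the first layer, [wreath H], let [t] be the translation and [f i] the ray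
    with value [x i] on the non-negative integers. Then [[~ t, f i]] is [x i],
    concentrated at the origin ([ray_isolation]). In the second layer,
    [wreath (wreath H)], take the translation, the element [c] equal to [t]
    concentrated at the origin, and a function [a] whose value at [2 ^ j] runs
    through [f 0], [t], [f 1], [t], ... and which is trivial elsewhere. The
    commutator of [c] with a suitable translate of [a] is [[~ t, f i]],
    concentrated at the origin ([spike_isolation]). Thus the three elements
    generate a group [G] containing a copy of [H], on which the order is the given
    one.

    The value of a word at a given coordinate is computed by walking along the
    word, so the order on [G] is computable provided that finitely many
    coordinates decide whether a word is trivial. For the first layer, the
    coordinates beyond the length of the word are all equal
    ([base_ray_window]). For the second layer, the powers of two are eventually
    sparse compared with the length of the word, so that a far coordinate is a
    power of the value of [a] at one place, and the exponent depends only on the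
    distance to that place; since the values [t], of infinite order, recur, a
    nonzero exponent shows up within a computable window
    ([base_spike_window]). The same windows decide whether a word represents an
    element concentrated at the origin, with a value concentrated at the origin,
    that is, an element of [H].

    Finally, [H] is normal in the subgroup of elements of [G] without translation
    in either layer; that subgroup is normal in the subgroup of elements without
    translation in the second layer, which is normal in [G]. *)

Set Implicit Arguments.
Unset Strict Implicit.
Unset Printing Implicit Defensive.

(** * Recursive functions of one and two variables *)
Lemma recursive_ext n (f g : n.-tuple nat -> nat) :
  recursive f -> (forall v, g v = f v) -> recursive g.
Proof.
move=> fR fg; apply: (rec_comp (g := fun i v => tnth v i) fR).
  by move=> i; apply: rec_proj.
by move=> v; rewrite fg; congr f; apply: eq_from_tnth => i; rewrite tnth_mktuple.
Qed.

Definition recursive1 (f : nat -> nat) :=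
  recursive (fun v : 1.-tuple nat => f (tnth v ord0)).

Definition recursive2 (f : nat -> nat -> nat) :=
  recursive (fun v : 2.-tuple nat => f (tnth v ord0) (tnth v (inord 1))).

Section Composition.
Variable n : nat.
Implicit Types g h : n.-tuple nat -> nat.

Lemma recursive_comp1 f g :
  recursive1 f -> recursive g -> recursive (fun v => f (g v)).
Proof.
move=> fR gR; apply: (rec_comp (g := fun _ => g) fR) => // v.
by rewrite tnth_mktuple.
Qed.

Lemma recursive_comp2 f g h :
  recursive2 f -> recursive g -> recursive h -> recursive (fun v => f (g v) (h v)).
Proof.
move=> fR gR hR.
apply: (rec_comp (g := fun i : 'I_2 => if i == ord0 then g else h) fR).
  by move=> i; case: ifP.
move=> v; rewrite !tnth_mktuple eqxx; case: eqP => // /(congr1 val).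
by rewrite /= inordK.
Qed.

Lemma recursive_const c : recursive (fun _ : n.-tuple nat => c).
Proof.
elim: c => [|c IHc]; first exact: rec_zero.
exact: (recursive_comp1 (f := succn) rec_succ IHc).
Qed.

End Composition.

Lemma recursive2_iteri (b : nat -> nat) (s : nat -> nat -> nat -> nat) :
  recursive1 b ->
  recursive (fun v : 3.-tuple nat =>
    s (tnth v ord0) (tnth v (inord 1)) (tnth v (inord 2))) ->
  recursive2 (fun k v => iteri k (fun i r => s i r v) (b v)).
Proof.
move=> bR sR; apply: (rec_prim bR sR) => [v|k v].
  by congr b; rewrite (tnth_nth 0) inordK //= (tnth_nth 0).
by rewrite !(tnth_nth 0) !inordK //=.
Qed.

Lemma recursive2_ext f g :
  recursive2 f -> (forall k v, g k v = f k v) -> recursive2 g.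
Proof. by move=> fR fg; apply: recursive_ext fR _ => v; apply: fg. Qed.

Lemma recursive1_ext f g : recursive1 f -> (forall n, g n = f n) -> recursive1 g.
Proof. by move=> fR fg; apply: recursive_ext fR _ => v; apply: fg. Qed.

Lemma recursive1_comp f g :
  recursive1 f -> recursive1 g -> recursive1 (fun n => f (g n)).
Proof. exact: recursive_comp1. Qed.

Lemma recursive1_comp2 f g h :
  recursive2 f -> recursive1 g -> recursive1 h ->
  recursive1 (fun n => f (g n) (h n)).
Proof. exact: recursive_comp2. Qed.

Lemma recursive1_id : recursive1 id.
Proof. exact: rec_proj. Qed.

Lemma recursive1_const c : recursive1 (fun=> c).
Proof. exact: recursive_const. Qed.

Lemma recursive2_diag f : recursive2 f -> recursive1 (fun n => f n n).
Proof. by move=> fR; apply: (recursive1_comp2 fR) recursive1_id recursive1_id. Qed.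

Lemma recursive1_succ : recursive1 succn.
Proof. exact: rec_succ. Qed.

Lemma recursive2_swap f : recursive2 f -> recursive2 (fun m n => f n m).
Proof. by move=> fR; apply: (recursive_comp2 fR); apply: rec_proj. Qed.

Lemma recursive2_add : recursive2 addn.
Proof.
apply: recursive2_ext (recursive2_iteri (s := fun _ r _ => r.+1) recursive1_id _) _.
  by apply: (recursive_comp1 recursive1_succ); apply: rec_proj.
by elim=> //= k IHk v; rewrite addSn IHk.
Qed.

Lemma recursive2_mul : recursive2 muln.
Proof.
have sR := recursive2_iteri (s := fun _ r v => v + r) (recursive1_const 0) _.
apply: recursive2_ext (sR _) _.
  by apply: (recursive_comp2 recursive2_add); apply: rec_proj.
by elim=> //= k IHk v; rewrite mulSn IHk.
Qed.

Lemma recursive1_pred : recursive1 predn.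
Proof.
have sR := recursive2_iteri (s := fun i _ _ => i) (recursive1_const 0) _.
by apply: recursive1_ext (recursive2_diag (sR _)) _; [apply: rec_proj | case].
Qed.

Lemma recursive2_sub : recursive2 subn.
Proof.
apply: (recursive2_swap (f := fun m n => n - m)).
apply: recursive2_ext (recursive2_iteri (s := fun _ r _ => r.-1) recursive1_id _) _.
  by apply: (recursive_comp1 recursive1_pred); apply: rec_proj.
by elim=> [|k IHk] v; rewrite ?subn0 // subnS IHk.
Qed.

Lemma recursive1_odd : recursive1 (fun n => nat_of_bool (odd n)).
Proof.
have sR := recursive2_iteri (s := fun _ r _ => 1 - r) (recursive1_const 0) _.
apply: recursive1_ext (recursive2_diag (sR _)) _.
  by apply: (recursive_comp2 recursive2_sub); [apply: recursive_const|apply: rec_proj].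
by elim=> //= k <-; case: (odd k).
Qed.

Lemma recursive1_half : recursive1 half.
Proof.
have sR := recursive2_iteri (s := fun i r _ => odd i + r) (recursive1_const 0) _.
apply: recursive1_ext (recursive2_diag (sR _)) _.
  apply: (recursive_comp2 recursive2_add); last by apply: rec_proj.
  by apply: (recursive_comp1 recursive1_odd); apply: rec_proj.
by elim=> //= k <-; rewrite uphalf_half.
Qed.

Lemma recursive1_exp2 : recursive1 (expn 2).
Proof.
have sR := recursive2_iteri (s := fun i r _ => r + r) (recursive1_const 1) _.
apply: recursive1_ext (recursive2_diag (sR _)) _.
  by apply: (recursive_comp2 recursive2_add); apply: rec_proj.
by elim=> //= k <-; rewrite expnS mul2n addnn.
Qed.

Lemma recursive2_shift : recursive2 (fun k n => iter k half n).
Proof.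
apply: recursive2_ext (recursive2_iteri (s := fun _ r _ => r./2) recursive1_id _) _.
  by apply: (recursive_comp1 recursive1_half); apply: rec_proj.
by elim=> //= k IHk v; rewrite IHk.
Qed.

(** [pair_code m n] is the code of a list with head [m] whose tail has code
    [n], so that the codes of pairs and of lists are taken apart by the same two
    functions. *)
Definition pair_code (m n : nat) : nat := 2 ^ m * n.*2.+1.
Definition code_fst (c : nat) : nat := head 0 (CodeSeq.decode c).
Definition code_snd (c : nat) : nat := CodeSeq.code (behead (CodeSeq.decode c)).

Lemma decode_pair m n :
  CodeSeq.decode (pair_code m n) = m :: CodeSeq.decode n.
Proof. by rewrite -{1}[n]CodeSeq.decodeK -[RHS]CodeSeq.codeK. Qed.

Lemma code_fstK m n : code_fst (pair_code m n) = m.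
Proof. by rewrite /code_fst decode_pair. Qed.

Lemma code_sndK m n : code_snd (pair_code m n) = n.
Proof. by rewrite /code_snd decode_pair /= CodeSeq.decodeK. Qed.

Lemma code_pairP c : c = 0 \/ exists m n, c = pair_code m n.
Proof.
rewrite -[c]CodeSeq.decodeK; case: (CodeSeq.decode c) => [|m s]; first by left.
by right; exists m, (CodeSeq.code s).
Qed.

Lemma iter_half_pair m n k :
  k <= m -> iter k half (pair_code m n) = 2 ^ (m - k) * n.*2.+1.
Proof.
elim: k => [|k IHk] lekm /=; first by rewrite subn0.
rewrite IHk ?(ltnW lekm) // subnS; move: lekm; rewrite -subn_gt0.
by case: (m - k) => // d _; rewrite expnS -mulnA mul2n doubleK.
Qed.

Lemma recursive2_pair : recursive2 pair_code.
Proof.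
apply: (recursive_comp2 recursive2_mul).
  by apply: (recursive_comp1 recursive1_exp2); apply: rec_proj.
apply: (recursive_comp1 recursive1_succ).
have dblR : recursive1 double.
  by apply: recursive1_ext (recursive2_diag recursive2_add) _ => n; rewrite addnn.
by apply: (recursive_comp1 dblR); apply: rec_proj.
Qed.

(** Halving [pair_code m n] repeatedly leaves an odd number for the first time
    after [m] steps, so the first component is the result of a regular
    minimization. The factor [1 - (1 - c)] makes the search stop at once on the
    code [0], which is not that of a pair. *)
Lemma recursive1_fst : recursive1 code_fst.
Proof.
pose f k c := (1 - (1 - c)) * (1 - odd (iter k half c)).
have fR : recursive2 f.
  have one n := recursive_const n 1.
  apply: (recursive_comp2 recursive2_mul).
    by do 2!apply: (recursive_comp2 recursive2_sub) => //; apply: rec_proj.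
  apply: (recursive_comp2 recursive2_sub) => //.
  apply: (recursive_comp1 recursive1_odd).
  by apply: (recursive_comp2 recursive2_shift); apply: rec_proj.
apply: (rec_min fR) => [v|v k]; rewrite ?(tnth_nth 0) ?inordK //=;
  set c := nth 0 _ 0; have [->|[m [n ->]]] := code_pairP c; rewrite /f ?mul0n //.
  rewrite code_fstK iter_half_pair // subnn mul1n /= odd_double /=.
  by rewrite subnn muln0.
rewrite code_fstK => ltkm; rewrite iter_half_pair ?(ltnW ltkm) //.
rewrite oddM oddX subn_eq0 leqNgt ltkm /=.
suff: 0 < pair_code m n by case: (pair_code m n).
by rewrite muln_gt0 expn_gt0.
Qed.

Lemma recursive1_snd : recursive1 code_snd.
Proof.
apply: recursive1_ext (_ : recursive1 (fun c => (iter (code_fst c) half c)./2)) _.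
  apply: (recursive1_comp recursive1_half).
  exact: (recursive1_comp2 recursive2_shift recursive1_fst recursive1_id).
move=> c; have [->|[m [n ->]]] // := code_pairP c.
by rewrite code_fstK code_sndK iter_half_pair // subnn mul1n /= uphalf_double.
Qed.

Lemma recursive1_iteri (k b s : nat -> nat) :
  recursive1 k -> recursive1 b -> recursive1 s ->
  recursive1 (fun n =>
    iteri (k n) (fun i r => s (pair_code i (pair_code r n))) (b n)).
Proof.
move=> kR bR sR.
have itR := recursive2_iteri (s := fun i r n => s (pair_code i (pair_code r n))) bR.
apply: (recursive1_comp2 (itR _)) => //; last exact: recursive1_id.
apply: (recursive_comp1 sR); apply: (recursive_comp2 recursive2_pair).
  exact: rec_proj.
by apply: (recursive_comp2 recursive2_pair); apply: rec_proj.
Qed.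

Lemma recursive1_if c f g :
  recursive1 c -> recursive1 f -> recursive1 g ->
  recursive1 (fun n => if c n == 0 then g n else f n).
Proof.
move=> cR fR gR; have nR h : recursive1 h -> recursive1 (fun n => 1 - h n).
  exact: recursive1_comp2 recursive2_sub (recursive1_const 1).
apply: recursive1_ext (recursive1_comp2 recursive2_add
  (recursive1_comp2 recursive2_mul (nR _ cR) gR)
  (recursive1_comp2 recursive2_mul (nR _ (nR _ cR)) fR)) _ => n.
by case: (c n) => [|m] /=; rewrite ?subn0 ?subSS ?sub0n ?subnn ?mul1n ?mul0n ?addn0.
Qed.

(** * Computable functions between encoded types *)

(** Programs below are ordinary functions between encoded types, and closure
    properties replace explicit recursive functions. Codes of lists of numbers
    are the numbers that [word_code] produces. *)
Class encoding (A : Type) := encode : A -> nat.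

#[export] Instance nat_encoding : encoding nat := id.
#[export] Instance bool_encoding : encoding bool := nat_of_bool.
#[export] Instance pair_encoding A B (eA : encoding A) (eB : encoding B) :
  encoding (A * B) := fun p => pair_code (encode p.1) (encode p.2).
#[export] Instance seq_encoding A (eA : encoding A) : encoding (seq A) :=
  fun s => CodeSeq.code (map encode s).
#[export] Instance int_encoding : encoding int :=
  fun n => match n with Posz m => m.*2 | Negz m => m.*2.+1 end.

Definition computable A B {eA : encoding A} {eB : encoding B} (f : A -> B) :=
  exists2 F, recursive1 F & forall a, F (encode a) = encode (f a).

Section Combinators.
Context {E : Type} {eE : encoding E}.

Lemma computable_ext B {eB : encoding B} (f g : E -> B) :
  computable f -> (forall e, g e = f e) -> computable g.
Proof. by case=> F FR Ff fg; exists F => // a; rewrite fg. Qed.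

Lemma computable_id : computable (fun e : E => e).
Proof. by exists id; first exact: recursive1_id. Qed.

Lemma computable_const B {eB : encoding B} (b : B) : computable (fun _ : E => b).
Proof. by exists (fun=> encode b); first exact: recursive1_const. Qed.

Lemma computable_comp A B {eA : encoding A} {eB : encoding B}
    (g : A -> B) (f : E -> A) :
  computable g -> computable f -> computable (fun e => g (f e)).
Proof.
move=> [G GR Gg] [F FR Ff]; exists (fun n => G (F n)).
  exact: recursive1_comp.
by move=> a; rewrite Ff Gg.
Qed.

Lemma computable_pair A B {eA : encoding A} {eB : encoding B}
    (f : E -> A) (g : E -> B) :
  computable f -> computable g -> computable (fun e => (f e, g e)).
Proof.
move=> [F FR Ff] [G GR Gg]; exists (fun n => pair_code (F n) (G n)).
  exact: (recursive1_comp2 recursive2_pair).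
by move=> a; rewrite Ff Gg.
Qed.

Lemma computable_fst A B {eA : encoding A} {eB : encoding B} (f : E -> A * B) :
  computable f -> computable (fun e => (f e).1).
Proof.
move=> [F FR Ff]; exists (fun n => code_fst (F n)).
  exact: (recursive1_comp recursive1_fst).
by move=> a; rewrite Ff code_fstK.
Qed.

Lemma computable_snd A B {eA : encoding A} {eB : encoding B} (f : E -> A * B) :
  computable f -> computable (fun e => (f e).2).
Proof.
move=> [F FR Ff]; exists (fun n => code_snd (F n)).
  exact: (recursive1_comp recursive1_snd).
by move=> a; rewrite Ff code_sndK.
Qed.

Lemma computable_nat1 (op : nat -> nat) (f : E -> nat) :
  recursive1 op -> computable f -> computable (fun e => op (f e)).
Proof.
move=> opR [F FR Ff]; exists (fun n => op (F n)).
  exact: recursive1_comp.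
by move=> a; rewrite Ff.
Qed.

Lemma computable_nat2 (op : nat -> nat -> nat) (f g : E -> nat) :
  recursive2 op -> computable f -> computable g ->
  computable (fun e => op (f e) (g e)).
Proof.
move=> opR [F FR Ff] [G GR Gg]; exists (fun n => op (F n) (G n)).
  exact: recursive1_comp2.
by move=> a; rewrite Ff Gg.
Qed.

Lemma computable_encode A {eA : encoding A} (f : E -> A) :
  computable f -> computable (fun e => encode (f e)).
Proof. by []. Qed.

(** Decoding a list is free: the code of the decoded list is the number
    itself. *)
Lemma computable_decode (f : E -> nat) :
  computable f -> computable (fun e => CodeSeq.decode (f e)).
Proof.
move=> [F FR Ff]; exists F => // a; rewrite Ff.
by rewrite [RHS]/encode /seq_encoding map_id CodeSeq.decodeK.
Qed.

Lemma computable_succ (f : E -> nat) :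
  computable f -> computable (fun e => (f e).+1).
Proof. exact: computable_nat1 recursive1_succ. Qed.
Lemma computable_pred (f : E -> nat) :
  computable f -> computable (fun e => (f e).-1).
Proof. exact: computable_nat1 recursive1_pred. Qed.
Lemma computable_half (f : E -> nat) :
  computable f -> computable (fun e => (f e)./2).
Proof. exact: computable_nat1 recursive1_half. Qed.
Lemma computable_exp2 (f : E -> nat) :
  computable f -> computable (fun e => 2 ^ f e).
Proof. exact: computable_nat1 recursive1_exp2. Qed.
Lemma computable_add (f g : E -> nat) :
  computable f -> computable g -> computable (fun e => f e + g e).
Proof. exact: computable_nat2 recursive2_add. Qed.
Lemma computable_sub (f g : E -> nat) :
  computable f -> computable g -> computable (fun e => f e - g e).
Proof. exact: computable_nat2 recursive2_sub. Qed.
Lemma computable_double (f : E -> nat) :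
  computable f -> computable (fun e => (f e).*2).
Proof.
move=> fC; apply: computable_ext (computable_add fC fC) _ => e.
by rewrite addnn.
Qed.

Lemma computable_odd (f : E -> nat) :
  computable f -> computable (fun e => odd (f e)).
Proof.
move=> [F FR Ff]; exists (fun n => nat_of_bool (odd (F n))).
  exact: (recursive1_comp recursive1_odd).
by move=> a; rewrite Ff.
Qed.

Lemma computable_eq0 (f : E -> nat) :
  computable f -> computable (fun e => f e == 0).
Proof.
move=> [F FR Ff]; exists (fun n => 1 - F n).
  exact: (recursive1_comp2 recursive2_sub (recursive1_const 1)).
by move=> a; rewrite Ff /encode /nat_encoding /bool_encoding; case: (f a).
Qed.

Lemma computable_leq (f g : E -> nat) :
  computable f -> computable g -> computable (fun e => f e <= g e).
Proof. by move=> fC gC; apply/computable_eq0/computable_sub. Qed.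

Lemma computable_eqn (f g : E -> nat) :
  computable f -> computable g -> computable (fun e => f e == g e).
Proof.
move=> fC gC; apply: computable_ext (computable_eq0 (computable_add
  (computable_sub fC gC) (computable_sub gC fC))) _ => e.
by rewrite eqn_leq addn_eq0.
Qed.

Lemma computable_if B {eB : encoding B} (c : E -> bool) (f g : E -> B) :
  computable c -> computable f -> computable g ->
  computable (fun e => if c e then f e else g e).
Proof.
move=> [C CR Cc] [F FR Ff] [G GR Gg].
exists (fun n => if C n == 0 then G n else F n); first exact: recursive1_if.
by move=> a; rewrite Cc Ff Gg /encode /bool_encoding; case: (c a).
Qed.

Lemma computable_and (f g : E -> bool) :
  computable f -> computable g -> computable (fun e => f e && g e).
Proof. by move=> fC gC; apply: computable_if fC gC _; apply: computable_const. Qed.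
Lemma computable_or (f g : E -> bool) :
  computable f -> computable g -> computable (fun e => f e || g e).
Proof. by move=> fC gC; apply: computable_if fC _ gC; apply: computable_const. Qed.
Lemma computable_imp (f g : E -> bool) :
  computable f -> computable g -> computable (fun e => f e ==> g e).
Proof. by move=> fC gC; apply: computable_if fC gC _; apply: computable_const. Qed.

Lemma computable_iteri B {eB : encoding B} (k : E -> nat) (b : E -> B)
    (s : nat * (B * E) -> B) :
  computable k -> computable b -> computable s ->
  computable (fun e => iteri (k e) (fun i r => s (i, (r, e))) (b e)).
Proof.
move=> [K KR Kk] [F FR Fb] [S SR Ss].
exists (fun n => iteri (K n) (fun i r => S (pair_code i (pair_code r n))) (F n)).
  exact: recursive1_iteri.
move=> a; rewrite Kk Fb [encode (k a)]/encode /nat_encoding.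
by elim: (k a) => //= n ->; rewrite -Ss.
Qed.

Lemma computable_cons A {eA : encoding A} (f : E -> A) (g : E -> seq A) :
  computable f -> computable g -> computable (fun e => f e :: g e).
Proof. exact: computable_pair. Qed.

Lemma computable_case_seq A B {eA : encoding A} {eB : encoding B}
    (f : E -> seq A) (g : E -> B) (h : E * (A * seq A) -> B) :
  computable f -> computable g -> computable h ->
  computable (fun e => match f e with [::] => g e | a :: s => h (e, (a, s)) end).
Proof.
move=> [F FR Ff] [G GR Gg] [K KR Kh].
exists (fun n => if F n == 0 then G n else K (pair_code n (F n))).
  apply: (recursive1_if FR _ GR); apply: (recursive1_comp KR).
  exact: (recursive1_comp2 recursive2_pair recursive1_id FR).
move=> e; rewrite Ff Gg; case: (f e) => [|a s] //=.
rewrite [X in X == 0]/encode /seq_encoding /= muln_eq0 expn_eq0 /=.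
exact: (Kh (e, (a, s))).
Qed.

Lemma computable_case_int B {eB : encoding B}
    (f : E -> int) (g h : E * nat -> B) :
  computable f -> computable g -> computable h ->
  computable (fun e => match f e with Posz n => g (e, n) | Negz n => h (e, n) end).
Proof.
move=> [F FR Ff] [G GR Gg] [K KR Kh].
exists (fun n => if nat_of_bool (odd (F n)) == 0 then G (pair_code n (F n)./2)
                 else K (pair_code n (F n)./2)).
  have pR : recursive1 (fun n => pair_code n (F n)./2).
    apply: (recursive1_comp2 recursive2_pair recursive1_id).
    exact: (recursive1_comp recursive1_half).
  apply: recursive1_if; [|exact: recursive1_comp KR pR|exact: recursive1_comp GR pR].
  exact: (recursive1_comp recursive1_odd).
move=> e; rewrite Ff; case: (f e) => n.
  by rewrite -[encode (Posz n)]/n.*2 odd_double doubleK /= -(Gg (e, n)).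
rewrite -[encode (Negz n)]/n.*2.+1 /= odd_double /= uphalf_double.
by rewrite -(Kh (e, n)).
Qed.

Lemma computable_Posz (f : E -> nat) :
  computable f -> computable (fun e => Posz (f e)).
Proof. by case/computable_double=> F FR Ff; exists F => // e; rewrite Ff. Qed.

Lemma computable_Negz (f : E -> nat) :
  computable f -> computable (fun e => Negz (f e)).
Proof.
by case/computable_double/computable_succ=> F FR Ff; exists F => // e; rewrite Ff.
Qed.

End Combinators.

Ltac computable_tac := repeat match goal with
  | |- computable fst => apply: computable_fst; exact: computable_id
  | |- computable snd => apply: computable_snd; exact: computable_id
  | |- computable (fun e => e) => exact: computable_id
  | |- computable (fun _ => ?c) => exact: computable_const
  | |- computable (fun _ => (_, _)) => apply: computable_pair
  | |- computable (fun _ => fst _) => apply: computable_fst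
  | |- computable (fun _ => snd _) => apply: computable_snd
  | |- computable (fun _ => succn _) => apply: computable_succ
  | |- computable (fun _ => predn _) => apply: computable_pred
  | |- computable (fun _ => half _) => apply: computable_half
  | |- computable (fun _ => double _) => apply: computable_double
  | |- computable (fun _ => odd _) => apply: computable_odd
  | |- computable (fun _ => 2 ^ _) => apply: computable_exp2
  | |- computable (fun _ => _ + _) => apply: computable_add
  | |- computable (fun _ => _ - _) => apply: computable_sub
  | |- computable (fun _ => _ && _) => apply: computable_and
  | |- computable (fun _ => _ || _) => apply: computable_or
  | |- computable (fun _ => _ ==> _) => apply: computable_imp
  | |- computable (fun _ => _ == _) => apply: computable_eqn
  | |- computable (fun _ => _ <= _) => apply: computable_leq
  | |- computable (fun _ => Posz _) => apply: computable_Posz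
  | |- computable (fun _ => Negz _) => apply: computable_Negz
  | |- computable (fun _ => CodeSeq.decode _) => apply: computable_decode
  | |- computable (fun _ => _ :: _) => apply: computable_cons
  | |- computable (fun _ => if _ then _ else _) => apply: computable_if
  | fC : computable ?f |- computable ?f => exact: fC
  end.

Section SeqCombinators.
Context {E : Type} {eE : encoding E}.

Lemma computable_all_below (k : E -> nat) (p : nat * E -> bool) :
  computable k -> computable p ->
  computable (fun e => all (fun i => p (i, e)) (iota 0 (k e))).
Proof.
move=> kC pC.
apply: computable_ext (computable_iteri (s := fun q => q.2.1 && p (q.1, q.2.2))
  kC (computable_const true) _) _.
  by apply: computable_and; last apply: (computable_comp pC); computable_tac.
move=> e; elim: (k e) => // n IHn.
by rewrite -addn1 iotaD all_cat addn1 [iteri _ _ _]/= -IHn /= andbT andbC.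
Qed.

(** Iterates the step that moves one element from the list to the accumulator.
    The code of a list bounds its length, and surplus steps leave an exhausted
    list alone, so the code can serve as the number of iterations. *)
Lemma computable_foldl A B {eA : encoding A} {eB : encoding B}
    (l : E -> seq A) (b : E -> B) (s : A * (B * E) -> B) :
  computable l -> computable b -> computable s ->
  computable (fun e => foldl (fun r a => s (a, (r, e))) (b e) (l e)).
Proof.
move=> lC bC sC.
pose step (q : nat * ((seq A * B) * E)) : seq A * B :=
  match q.2.1.1 with
  | [::] => q.2.1
  | a :: r => (r, s (a, (q.2.1.2, q.2.2)))
  end.
have stepC : computable step.
  apply: (computable_case_seq (h := fun z => (z.2.2, s (z.2.1, (z.1.2.1.2, z.1.2.2))))).
  - by computable_tac.
  - by computable_tac.
  apply: computable_pair; first by computable_tac.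
  by apply: (computable_comp sC); computable_tac.
apply: computable_ext (computable_snd (computable_iteri
  (computable_encode lC) (computable_pair lC bC) stepC)) _ => e.
have iterE k : iteri k (fun i r => step (i, (r, e))) (l e, b e) =
    (drop k (l e), foldl (fun r a => s (a, (r, e))) (b e) (take k (l e))).
  elim: k => [|k IHk] /=; first by rewrite drop0 take0.
  rewrite {}IHk /step /=; have [lekl|gtkl] := leqP (size (l e)) k.
    by rewrite !drop_oversize ?take_oversize // ltnW.
  case Dl: (l e) gtkl => [|a0 l0] //; rewrite -Dl => gtkl.
  by rewrite (drop_nth a0) // (take_nth a0) // foldl_rcons.
rewrite iterE /= take_oversize // /encode /seq_encoding.
elim: (l e) => //= a r IHr; rewrite (leq_ltn_trans IHr) //.
set c := CodeSeq.code _; have: 0 < 2 ^ encode a by rewrite expn_gt0.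
by case: (2 ^ _) => // d _; rewrite mulSn; lia.
Qed.

Lemma computable_rev A {eA : encoding A} (f : E -> seq A) :
  computable f -> computable (fun e => rev (f e)).
Proof.
move=> fC; apply: computable_ext (computable_foldl (s := fun q => q.1 :: q.2.1)
  fC (computable_const [::]) _) _; first by computable_tac.
by move=> e /=; rewrite /rev; elim: (f e) [::] => //= a s IHs r; apply: IHs.
Qed.

Lemma computable_cat A {eA : encoding A} (f g : E -> seq A) :
  computable f -> computable g -> computable (fun e => f e ++ g e).
Proof.
move=> fC gC; apply: computable_ext (computable_foldl (s := fun q => q.1 :: q.2.1)
  (computable_rev fC) gC _) _; first by computable_tac.
by move=> e /=; rewrite foldl_rev; elim: (f e) => //= a s ->.
Qed.

Lemma computable_map A B {eA : encoding A} {eB : encoding B}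
    (f : E -> seq A) (h : A * E -> B) :
  computable f -> computable h -> computable (fun e => [seq h (a, e) | a <- f e]).
Proof.
move=> fC hC; apply: computable_ext (computable_foldl
  (s := fun q => h (q.1, q.2.2) :: q.2.1) (computable_rev fC)
  (computable_const [::]) _) _.
  by apply: computable_cons; [apply: (computable_comp hC)|]; computable_tac.
by move=> e /=; rewrite foldl_rev; elim: (f e) => //= a s ->.
Qed.

End SeqCombinators.

Section MoreSeqCombinators.
Context {E : Type} {eE : encoding E}.

Lemma computable_flatten_map A B {eA : encoding A} {eB : encoding B}
    (f : E -> seq A) (h : A * E -> seq B) :
  computable f -> computable h ->
  computable (fun e => flatten [seq h (a, e) | a <- f e]).
Proof.
move=> fC hC; apply: computable_ext (computable_foldl
  (s := fun q => h (q.1, q.2.2) ++ q.2.1) (computable_rev fC)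
  (computable_const [::]) _) _.
  by apply: computable_cat; [apply: (computable_comp hC)|]; computable_tac.
by move=> e /=; rewrite foldl_rev; elim: (f e) => //= a s ->.
Qed.

Lemma computable_filter A {eA : encoding A} (f : E -> seq A) (p : A * E -> bool) :
  computable f -> computable p ->
  computable (fun e => [seq a <- f e | p (a, e)]).
Proof.
move=> fC pC; apply: computable_ext (computable_foldl
  (s := fun q => if p (q.1, q.2.2) then q.1 :: q.2.1 else q.2.1)
  (computable_rev fC) (computable_const [::]) _) _.
  apply: computable_if; [by apply: (computable_comp pC); computable_tac| |];
  by computable_tac.
by move=> e /=; rewrite foldl_rev; elim: (f e) => //= a s ->.
Qed.

Lemma computable_size A {eA : encoding A} (f : E -> seq A) :
  computable f -> computable (fun e => size (f e)).
Proof.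
move=> fC; apply: computable_ext (computable_foldl (s := fun q => q.2.1.+1)
  (computable_rev fC) (computable_const 0) _) _; first by computable_tac.
by move=> e /=; rewrite foldl_rev; elim: (f e) => //= a s ->.
Qed.

End MoreSeqCombinators.

Import Order.TTheory GRing.Theory Num.Theory.
Local Open Scope group_scope.

(** * Words as lists of numbers *)

(** Words are handled as lists of letters, the letter [2 i + b] standing for the
    generator of index [i] or its inverse; by [letters_code] the number that codes
    a word is the code of this list. *)
Definition letters (I : Type) (idx : I -> nat) (w : word I) : seq nat :=
  [seq ((idx l.1).*2 + nat_of_bool l.2)%N | l : I * bool <- w].

Section Eval.
Variables (G : groupType) (x : nat -> G).

Definition eval_letter (l : nat) : G := if odd l then (x l./2)^-1 else x l./2.
Definition eval (w : seq nat) : G := \prod_(l <- w) eval_letter l.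

Lemma eval_nil : eval [::] = 1.
Proof. exact: big_nil. Qed.

Lemma eval_cons l w : eval (l :: w) = eval_letter l * eval w.
Proof. exact: big_cons. Qed.

Lemma eval_cat v w : eval (v ++ w) = eval v * eval w.
Proof. exact: big_cat. Qed.

Lemma eval_seq1 l : eval [:: l] = eval_letter l.
Proof. exact: big_seq1. Qed.

Lemma eval_double i : eval_letter i.*2 = x i.
Proof. by rewrite /eval_letter odd_double doubleK. Qed.

Lemma eval_doubleS i : eval_letter i.*2.+1 = (x i)^-1.
Proof. by rewrite /eval_letter /= odd_double uphalf_double. Qed.

End Eval.

Lemma eval_letters (G : groupType) (I : Type) (idx : I -> nat) (x : nat -> G) w :
  eval x (letters idx w) = word_value (fun i => x (idx i)) w.
Proof.
rewrite /eval big_map; apply: eq_bigr => -[i b] _ /=.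
by case: b; rewrite ?addn1 ?addn0 ?eval_double ?eval_doubleS.
Qed.

Definition flip_letter (l : nat) : nat := if odd l then l.-1 else l.+1.
Definition inv_letters (w : seq nat) : seq nat := rev [seq flip_letter l | l <- w].

Lemma half_flip_letter l : (flip_letter l)./2 = l./2.
Proof. by rewrite /flip_letter; case: ifP => odd_l; lia. Qed.

Lemma eval_flip (G : groupType) (x : nat -> G) l :
  eval_letter x (flip_letter l) = (eval_letter x l)^-1.
Proof.
rewrite /eval_letter half_flip_letter.
have -> : odd (flip_letter l) = ~~ odd l by rewrite /flip_letter; case: ifP; lia.
by case: (odd l); rewrite /= ?invgK.
Qed.

Lemma eval_inv (G : groupType) (x : nat -> G) w :
  eval x (inv_letters w) = (eval x w)^-1.
Proof.
elim: w => [|l w IHw]; first by rewrite eval_nil invg1 -(eval_nil x).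
rewrite /inv_letters /= rev_cons -cats1 eval_cat IHw eval_seq1 eval_flip.
by rewrite eval_cons invgM.
Qed.

Lemma computable_flip E (eE : encoding E) (f : E -> nat) :
  computable f -> computable (fun e => flip_letter (f e)).
Proof. by move=> fC; rewrite /flip_letter; computable_tac. Qed.

Lemma computable_inv E (eE : encoding E) (f : E -> seq nat) :
  computable f -> computable (fun e => inv_letters (f e)).
Proof.
move=> fC; apply: computable_rev.
apply: (computable_map (h := fun z => flip_letter z.1) fC).
by apply: computable_flip; computable_tac.
Qed.

Lemma letters_code I (idx : I -> nat) w : word_code idx w = encode (letters idx w).
Proof. by rewrite /encode /seq_encoding /= map_id. Qed.

Lemma recursive_wordsI I (idx : I -> nat) (P : word I -> Prop) (p : seq nat -> bool) :
  computable p -> (forall w, P w <-> p (letters idx w)) -> recursive_words idx P.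
Proof.
move=> [F FR Fp] Pp; exists (fun v => F (tnth v ord0)) => // w.
rewrite (tnth_nth 0) /= letters_code Fp Pp /encode /bool_encoding.
by case: (p _); split.
Qed.

Lemma recursive_wordsE I (idx : I -> nat) (P : word I -> Prop) :
  recursive_words idx P ->
  exists2 p : seq nat -> bool, computable p & forall w, P w <-> p (letters idx w).
Proof.
move=> [f fR Pf]; pose F n := f [tuple n].
have FR : recursive1 F.
  apply: recursive_ext fR _ => v; congr f; apply: eq_from_tnth => i.
  by rewrite ord1.
exists (fun w : seq nat => F (encode w) == 1%N).
  apply: computable_eqn; last by computable_tac.
  exact: computable_nat1 FR (computable_encode computable_id).
by move=> w; rewrite Pf letters_code; split=> [/eqP|/eqP].
Qed.

Lemma recursive_word_pairsI I (idx : I -> nat) (P : word I -> word I -> Prop)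
    (p : seq nat * seq nat -> bool) :
  computable p -> (forall u v, P u v <-> p (letters idx u, letters idx v)) ->
  recursive_word_pairs idx P.
Proof.
move=> [F FR Fp] Pp.
exists (fun v => F (pair_code (tnth v ord0) (tnth v (inord 1)))).
  apply: (recursive_comp1 FR); apply: (recursive_comp2 recursive2_pair);
  exact: rec_proj.
move=> u v; rewrite !(tnth_nth 0) inordK //= !letters_code Pp.
have /= -> := Fp (letters idx u, letters idx v).
by rewrite /encode /bool_encoding; case: (p _); split.
Qed.

Lemma recursive_word_pairsE I (idx : I -> nat) (P : word I -> word I -> Prop) :
  recursive_word_pairs idx P ->
  exists2 p : seq nat * seq nat -> bool, computable p &
    forall u v, P u v <-> p (letters idx u, letters idx v).
Proof.
move=> [f fR Pf]; pose F m n := f [tuple m; n].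
have FR : recursive2 F.
  apply: recursive_ext fR _ => v; congr f; apply: eq_from_tnth => i.
  rewrite !(tnth_nth 0) inordK //=.
  by case: i => [[|[|i]] //= lti]; rewrite !(tnth_nth 0).
exists (fun w : seq nat * seq nat => F (encode w.1) (encode w.2) == 1%N).
  apply: computable_eqn; last by computable_tac.
  by apply: (computable_nat2 FR); apply: (computable_encode (f := _)); computable_tac.
by move=> u v; rewrite Pf !letters_code; split=> [/eqP|/eqP].
Qed.

(** * Positive cones *)
(** A left-invariant order is determined by the elements above [1], and deciding
    the order on pairs of words amounts to deciding this set on single words. The
    order is a bi-order exactly when the set is invariant under conjugation. *)
Definition cone (G : groupType) (P : pred G) : Prop :=
  [/\ P 1, forall x, P x -> P x^-1 -> x = 1,
      forall x y, P x -> P y -> P (x * y) & forall x, P x || P x^-1].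

Definition is_cone (k : order_kind) (G : groupType) (P : pred G) : Prop :=
  cone P /\ (k = BiOrder -> forall x y, P x -> P (x ^ y)).

Definition cone_order (G : groupType) (P : pred G) : rel G :=
  fun x y => P (x^-1 * y).

Lemma cone_order_is_order k (G : groupType) (P : pred G) :
  is_cone k P -> is_order k (cone_order P).
Proof.
move=> [[P1 PV PM PT] PJ].
have leL : left_order (cone_order P).
  split; [split|] => [x|x y /andP[]|y x z|x y|a x y]; rewrite /cone_order.
  - by rewrite mulVg.
  - move=> Pxy Pyx; have := PV _ Pxy; rewrite invgM invgK => /(_ Pyx) /eqP.
    by rewrite mulg_eq1 eqg_inv => /eqP.
  - by move=> Pxy Pyz; have := PM _ _ Pxy Pyz; rewrite mulgA mulgK.
  - by have := PT (x^-1 * y); rewrite invgM invgK.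
  by rewrite invgM -mulgA mulKg.
case: k PJ => PJ; first exact: leL.
split=> // a x y; rewrite /cone_order => Pxy.
by have := PJ erefl _ a Pxy; rewrite /conjg invgM !mulgA.
Qed.

Lemma is_order_cone k (G : groupType) (le : rel G) :
  is_order k le ->
  is_cone k (le 1) /\ forall x y, le x y = cone_order (le 1) x y.
Proof.
move=> leO; have leL : left_order le by case: k leO => // -[].
have [[leR leA leT leTot] leM] := leL.
have leE x y : le x y = le 1 (x^-1 * y).
  by apply/idP/idP=> [/(leM x^-1)|/(leM x)]; rewrite ?mulVg ?mulg1 ?mulVKg.
split=> //; split; first split.
- exact: leR.
- move=> x le1x; rewrite -[x^-1]mulg1 -leE => lex1.
  by apply: leA; rewrite lex1 le1x.
- by move=> x y le1x le1y; apply: leT le1x _; rewrite leE mulKg.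
- by move=> x; rewrite -[x^-1]mulg1 -leE leTot.
case: k leO => // -[_ leMr] _ x y le1x.
by rewrite conjgE -leE -[y in le y _]mul1g; apply: leMr.
Qed.

(** * Wreath products with the integers *)

Section Wreath.
Variable A : groupType.

Definition bounded_below (f : int -> A) : Prop :=
  exists N : int, forall n, (n < N)%R -> f n = 1.

(** The pair [(f, k)] is a function [f] followed by the translation [k]. Arbitrary
    functions would not do: the lexicographic order needs every nontrivial [f] to
    have a first nontrivial value. *)
Definition wreath : Type :=
  {z : (int -> A) * int | `[< bounded_below z.1 >]}.

HB.instance Definition _ := Choice.copy wreath
  {z : (int -> A) * int | `[< bounded_below z.1 >]}.

Definition Wreath (f : int -> A) (k : int) (bf : bounded_below f) : wreath :=
  exist _ (f, k) (asboolT bf).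

Definition base (z : wreath) : int -> A := (val z).1.
Definition shift (z : wreath) : int := (val z).2.

Lemma base_bounded z : bounded_below (base z).
Proof. exact: asboolW (valP z). Qed.

Lemma wreath_eq (z w : wreath) : base z =1 base w -> shift z = shift w -> z = w.
Proof.
move=> eq_b eq_s; apply: val_inj.
rewrite [val z]surjective_pairing [val w]surjective_pairing; congr pair => //.
exact: funext.
Qed.

Lemma bounded_below1 : bounded_below (fun=> 1).
Proof. by exists 0%R. Qed.

Lemma bounded_belowV f : bounded_below f -> bounded_below (fun n => (f n)^-1).
Proof. by case=> N fN; exists N => n /fN ->; rewrite invg1. Qed.

Lemma bounded_belowM f g :
  bounded_below f -> bounded_below g -> bounded_below (fun n => f n * g n).
Proof.
move=> [N fN] [M gM]; exists (Num.min N M) => n ltn.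
by rewrite fN ?gM ?mulg1 //; lia.
Qed.

Lemma bounded_below_shift f k :
  bounded_below f -> bounded_below (fun n => f (n + k)%R).
Proof. by case=> N fN; exists (N - k)%R => n ltn; apply: fN; lia. Qed.

Definition wreath_one : wreath := Wreath 0%R bounded_below1.

Definition wreath_mul (z w : wreath) : wreath :=
  Wreath (shift z + shift w)%R
    (bounded_belowM (base_bounded z) (bounded_below_shift (shift z) (base_bounded w))).

Definition wreath_inv (z : wreath) : wreath :=
  Wreath (- shift z)%R
    (bounded_belowV (bounded_below_shift (- shift z)%R (base_bounded z))).

Lemma wreath_mulA : associative wreath_mul.
Proof.
move=> z w y; apply: wreath_eq => [n|]; rewrite /base /shift /= ?addrA //.
by rewrite mulgA.
Qed.

Lemma wreath_mul1 : left_id wreath_one wreath_mul.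
Proof.
move=> z; apply: wreath_eq => [n|]; rewrite /base /shift /= ?add0r //.
by rewrite mul1g addr0.
Qed.

Lemma wreath_mulr1 : right_id wreath_one wreath_mul.
Proof.
move=> z; apply: wreath_eq => [n|]; rewrite /base /shift /= ?addr0 //.
by rewrite mulg1.
Qed.

Lemma wreath_mulV : left_inverse wreath_one wreath_inv wreath_mul.
Proof.
move=> z; apply: wreath_eq => [n|]; rewrite /base /shift /= ?addNr //.
by rewrite mulVg.
Qed.

Lemma wreath_mulrV : right_inverse wreath_one wreath_inv wreath_mul.
Proof.
move=> z; apply: wreath_eq => [n|]; rewrite /base /shift /= ?subrr //.
rewrite -[LHS]/(base z n * (base z (n + shift z - shift z)%R)^-1).
by rewrite addrK mulgV.
Qed.

HB.instance Definition _ := isGroup.Build wreath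
  wreath_mulA wreath_mul1 wreath_mulr1 wreath_mulV wreath_mulrV.

Lemma base1 n : base (1 : wreath) n = 1. Proof. by []. Qed.
Lemma shift1 : shift (1 : wreath) = 0%R. Proof. by []. Qed.
Lemma baseM (z w : wreath) n : base (z * w) n = base z n * base w (n + shift z)%R.
Proof. by []. Qed.
Lemma shiftM (z w : wreath) : shift (z * w) = (shift z + shift w)%R.
Proof. by []. Qed.
Lemma baseV (z : wreath) n : base z^-1 n = (base z (n - shift z)%R)^-1.
Proof. by []. Qed.
Lemma shiftV (z : wreath) : shift z^-1 = (- shift z)%R. Proof. by []. Qed.

Lemma shiftJ (g h : wreath) : shift (g ^ h) = shift g.
Proof. by rewrite !shiftM shiftV; lia. Qed.

Lemma baseJ (g h : wreath) n :
  shift g = 0%R -> base (g ^ h) n = base g (n - shift h)%R ^ base h (n - shift h)%R.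
Proof. by move=> g0; rewrite baseM baseV baseM g0 addr0 shiftV. Qed.

End Wreath.

Section WreathCone.
Variables (k : order_kind) (A : groupType) (P : pred A).
Hypothesis coneP : is_cone k P.

(** The lexicographic cone: translation first, then the first nontrivial
    coordinate. The formula quantifies over every [n] to the left of which [f] is
    trivial: up to the first nontrivial coordinate this only asks for [P 1], at it
    the sign is tested, and no later [n] qualifies. *)
Definition wreath_cone : pred (wreath A) := fun z =>
  `[< (0 < shift z)%R \/ shift z = 0%R /\
      forall n, (forall m, (m < n)%R -> base z m = 1) -> P (base z n) >].

(** Strong induction over the integers, started far to the left. *)
Lemma int_lt_ind (Q : int -> Prop) :
  (exists N : int, forall n, (n < N)%R -> Q n) ->
  (forall n, (forall m, (m < n)%R -> Q m) -> Q n) -> forall n, Q n.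
Proof.
move=> [N QN] Qn n.
have QNj j : forall m, (m < N + Posz j)%R -> Q m.
  elim: j => [|j IHj] m ltm; first by apply: QN; lia.
  by apply: Qn => i ltim; apply: IHj; lia.
by apply: (QNj (absz (n + 1 - N)%R)); lia.
Qed.

(** Conjugation by [(g, l)] translates the coordinates by [l] and conjugates each
    of them, so it respects the first nontrivial coordinate and its sign; this is
    why bi-orders are inherited as well as left-orders. *)
Lemma wreath_cone_is_cone : is_cone k wreath_cone.
Proof.
have [[P1 PV PM PT] PJ] := coneP.
split; first split.
- by apply/asboolP; right; split=> // n _.
- move=> z /asboolP Pz /asboolP PVz; apply: wreath_eq; last first.
    by move: Pz PVz; rewrite shiftV shift1; lia.
  have z0 : shift z = 0%R by move: Pz PVz; rewrite shiftV; lia.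
  apply: (int_lt_ind (base_bounded z)) => n zn.
  apply: PV; first by case: Pz => [|[_ ->//]]; rewrite z0.
  case: PVz => [|[_ /(_ n)]]; first by rewrite shiftV z0.
  by rewrite baseV z0 subr0; apply=> m /zn; rewrite baseV z0 subr0 => ->; rewrite invg1.
- move=> z w /asboolP Pz /asboolP Pw; apply/asboolP; rewrite shiftM.
  case: Pz => [z_gt0|[z0 Pz]]; first by left; move: Pw; lia.
  case: Pw => [w_gt0|[w0 Pw]]; first by left; lia.
  right; split=> [|n]; first by rewrite z0 w0.
  have baseE m : base (z * w) m = base z m * base w m by rewrite baseM z0 addr0.
  move=> zw1; suff zw m : (m < n)%R -> base z m = 1 /\ base w m = 1.
    by rewrite baseE; apply: PM; [apply: Pz | apply: Pw] => m /zw [].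
  move: m; apply: int_lt_ind => [|m IHm ltmn].
    have [[N zN] [M wM]] := (base_bounded z, base_bounded w).
    by exists (Num.min N M) => m ltm _; rewrite zN ?wM //; lia.
  (* At m both values lie in the cone and are mutually inverse, hence trivial. *)
  have Pzm : P (base z m) by apply: Pz => i ltim; case: (IHm i ltim (lt_trans ltim ltmn)).
  have Pwm : P (base w m) by apply: Pw => i ltim; case: (IHm i ltim (lt_trans ltim ltmn)).
  have /mulg1_eq zwm : base z m * base w m = 1 by rewrite -baseE zw1.
  have zm1 : base z m = 1 by apply: PV; rewrite ?zwm.
  by rewrite -zwm zm1 invg1.
- move=> z; have [z0|] := eqVneq (shift z) 0%R; last first.
    case: (ltP 0%R (shift z)) => z_gt0 z_n0; apply/orP; [left|right].
      by apply/asboolP; left.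
    by apply/asboolP; left; rewrite shiftV; lia.
  rewrite -implyNb; apply/implyP => /asboolP notPz.
  apply/asboolP; right; rewrite shiftV z0 oppr0; split=> // n Vz1.
  rewrite baseV z0 subr0.
  have [//|notPzn] := boolP (P (base z n)^-1).
  case: notPz; right; split=> // i z1.
  have [ltin|ltni|->] := ltgtP i n.
  - by rewrite -[base z i]invgK -[i]subr0 -z0 -baseV Vz1 // invg1.
  - by case/negP: notPzn; rewrite z1 // invg1.
  by have := PT (base z n); rewrite (negPf notPzn) orbF.
move=> kB z w /asboolP Pz; apply/asboolP.
rewrite shiftJ; case: Pz => [|[z0 Pz]]; [by left | right; split=> // n].
move=> zw1; rewrite baseJ //; apply: PJ => //; apply: Pz => m ltm.
have := zw1 (m + shift w)%R; rewrite baseJ // addrK => zw1m.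
by apply/eqP; rewrite -(conjg_eq1 _ (base w m)); apply/eqP/zw1m; lia.
Qed.

End WreathCone.

(** * Computing coordinates of words in a wreath product *)

Section IntCombinators.
Context {E : Type} {eE : encoding E}.

Lemma computable_int_succ (f : E -> int) :
  computable f -> computable (fun e => (f e + 1)%R).
Proof.
move=> fC; apply: computable_ext (computable_case_int (g := fun p => Posz p.2.+1)
  (h := fun p => if p.2 == 0%N then Posz 0 else Negz p.2.-1) fC _ _) _.
- by computable_tac.
- by computable_tac.
by move=> e; case: (f e) => [n|[|n]] /=; lia.
Qed.

Lemma computable_int_pred (f : E -> int) :
  computable f -> computable (fun e => (f e - 1)%R).
Proof.
move=> fC; apply: computable_ext (computable_case_int
  (g := fun p => if p.2 == 0%N then Negz 0 else Posz p.2.-1)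
  (h := fun p => Negz p.2.+1) fC _ _) _.
- by computable_tac.
- by computable_tac.
by move=> e; case: (f e) => [[|n]|n] /=; lia.
Qed.

Lemma computable_int_sub (f g : E -> nat) :
  computable f -> computable g -> computable (fun e => (Posz (f e) - Posz (g e))%R).
Proof.
move=> fC gC; apply: computable_ext (_ : computable (fun e =>
  if g e <= f e then Posz (f e - g e) else Negz (g e - f e).-1)) _.
  by computable_tac.
by move=> e; case: leqP => le_gf; lia.
Qed.

Lemma computable_int_gt0 (f : E -> int) :
  computable f -> computable (fun e => (0 < f e)%R).
Proof.
move=> fC; apply: computable_ext (computable_case_int (g := fun p => 0 < p.2)
  (h := fun p => false) fC _ _) _.
- by computable_tac.
- by computable_tac.
by move=> e; case: (f e) => n /=; lia.
Qed.

Lemma computable_int_eq0 (f : E -> int) :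
  computable f -> computable (fun e => f e == 0%R).
Proof.
move=> fC; apply: computable_ext (computable_case_int (g := fun p => p.2 == 0%N)
  (h := fun p => false) fC _ _) _.
- by computable_tac.
- by computable_tac.
by move=> e; case: (f e) => n /=; lia.
Qed.

End IntCombinators.

Definition word_decidable (G : groupType) (x : nat -> G) (P : G -> Prop) : Prop :=
  exists2 p : seq nat -> bool, computable p & forall w, P (eval x w) <-> p w.

Section Generators.
Variable A : groupType.

Definition wreath_shift : wreath A := Wreath 1%R (@bounded_below1 A).
Definition wreath_base (f : int -> A) (bf : bounded_below f) : wreath A :=
  Wreath 0%R bf.

(** The subset [Q] of [A], copied to the coordinate [0]. *)
Definition at_origin (Q : A -> Prop) (g : wreath A) : Prop :=
  [/\ shift g = 0%R, forall n, n <> 0%R -> base g n = 1 & Q (base g 0%R)].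

Lemma base_shift n : base wreath_shift n = 1. Proof. by []. Qed.
Lemma shift_shift : shift wreath_shift = 1%R. Proof. by []. Qed.
Lemma shift_shiftX n : shift (wreath_shift ^+ n) = Posz n.
Proof. by elim: n => // n IHn; rewrite expgS shiftM IHn shift_shift; lia. Qed.

Lemma base_shiftX n m : base (wreath_shift ^+ n) m = 1.
Proof. by elim: n m => // n IHn m; rewrite expgS baseM IHn base_shift mulg1. Qed.

Lemma base_base f (bf : bounded_below f) : base (wreath_base bf) = f.
Proof. by []. Qed.
Lemma shift_base f (bf : bounded_below f) : shift (wreath_base bf) = 0%R.
Proof. by []. Qed.

End Generators.

Section WreathWords.
Variables (A : groupType) (x : nat -> A) (B : nat * nat -> seq nat).

Definition coordinate_word (j : nat) (n : int) : seq nat :=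
  match n with Posz m => B (j, m) | Negz _ => [::] end.

Definition coordinate (j : nat) (n : int) : A := eval x (coordinate_word j n).

Lemma coordinate_neg j n : (n < 0)%R -> coordinate j n = 1.
Proof. by case: n => // n _; apply: eval_nil. Qed.

Lemma coordinate_bounded j : bounded_below (coordinate j).
Proof. by exists 0%R => n; apply: coordinate_neg. Qed.

(** Generators with odd index are all the translation [t]; those with even index
    are the functions prescribed by [B]. Repeating [t] costs nothing for the
    generated group, and makes an element of infinite order occur in any sparse
    listing of the generators. *)
Definition wreath_gen (i : nat) : wreath A :=
  if odd i then wreath_shift A else wreath_base (coordinate_bounded i./2).

Lemma shift_letter l :
  shift (eval_letter wreath_gen l) =
    if odd l./2 then if odd l then (- 1)%R else 1%R else 0%R.
Proof. by rewrite /eval_letter /wreath_gen; case: (odd l); case: (odd l./2). Qed.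

Lemma base_letter l n :
  base (eval_letter wreath_gen l) n =
    if odd l./2 then 1
    else if odd l then (coordinate l./2./2 n)^-1 else coordinate l./2./2 n.
Proof.
rewrite /eval_letter /wreath_gen; case: (odd l); case: (odd l./2) => //.
  by rewrite baseV base_shift invg1.
by rewrite baseV shift_base subr0.
Qed.

Lemma base_eval_cons l u n :
  base (eval wreath_gen (l :: u)) n =
  base (eval_letter wreath_gen l) n *
  base (eval wreath_gen u) (n + shift (eval_letter wreath_gen l))%R.
Proof. by rewrite eval_cons baseM. Qed.

Lemma base_eval_neg u n :
  (n < - Posz (size u))%R -> base (eval wreath_gen u) n = 1.
Proof.
elim: u n => [|l u IHu] n /= ltn; first by rewrite eval_nil.
rewrite base_eval_cons IHu; last by rewrite shift_letter; do 2?case: ifP; lia.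
by rewrite base_letter coordinate_neg ?invg1 ?mulg1; [do 2?case: ifP | lia].
Qed.

(** Reading a word from the left, the translations move the current coordinate
    and every other letter contributes its value at that coordinate. *)
Definition walk (st : int * seq nat) (l : nat) : int * seq nat :=
  if odd l./2 then (if odd l then (st.1 - 1)%R else (st.1 + 1)%R, st.2)
  else (st.1, st.2 ++ (if odd l then inv_letters (coordinate_word l./2./2 st.1)
                       else coordinate_word l./2./2 st.1)).

Definition trace (n : int) (u : seq nat) : int * seq nat := foldl walk (n, [::]) u.

Lemma foldl_walk n v u :
  let: (m, w) := foldl walk (n, v) u in
  m = (n + shift (eval wreath_gen u))%R /\
  eval x w = eval x v * base (eval wreath_gen u) n.
Proof.
elim: u n v => [|l u IHu] n v /=; first by rewrite eval_nil shift1 base1 mulg1 addr0.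
case Ew: (walk (n, v) l) => [m w]; have := IHu m w.
case: foldl => m' w' [-> ->]; rewrite base_eval_cons eval_cons shiftM.
rewrite shift_letter base_letter; move: Ew; rewrite /walk /=.
by have [_|_] := ifP; case: (odd l) => -[<- <-];
  rewrite ?eval_cat ?eval_inv ?mul1g ?add0r ?addr0 ?addrA ?mulgA.
Qed.

Lemma trace_shift n u : (trace n u).1 = (n + shift (eval wreath_gen u))%R.
Proof. by have := foldl_walk n [::] u; rewrite /trace; case: foldl => m w []. Qed.

Lemma trace_base n u : eval x (trace n u).2 = base (eval wreath_gen u) n.
Proof.
have := foldl_walk n [::] u; rewrite /trace; case: foldl => m w [_ ->] /=.
by rewrite eval_nil mul1g.
Qed.

Hypothesis BC : computable B.

Lemma computable_trace E (eE : encoding E) (n : E -> int) (u : E -> seq nat) :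
  computable n -> computable u -> computable (fun e => trace (n e) (u e)).
Proof.
move=> nC uC; apply: (computable_foldl (s := fun p => walk p.2.1 p.1) uC).
  by apply: computable_pair nC _; computable_tac.
rewrite /walk; apply: computable_if; first by computable_tac.
  apply: computable_pair; last by computable_tac.
  apply: computable_if; first by computable_tac.
    by apply: computable_int_pred; computable_tac.
  by apply: computable_int_succ; computable_tac.
have wC : computable (fun p : nat * ((int * seq nat) * E) =>
    coordinate_word p.1./2./2 p.2.1.1).
  apply: (computable_case_int (g := fun q => B (q.1.1./2./2, q.2))
    (h := fun=> [::])); try by computable_tac.
  by apply: (computable_comp BC); computable_tac.
apply: computable_pair; first by computable_tac.
apply: computable_cat; first by computable_tac.
by apply: computable_if => //; [computable_tac | apply: computable_inv].
Qed.

(** Deciding anything about an element requires looking at finitely many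
    coordinates only. The bound [beta] provides them: a word that is trivial on
    the positive part of its window is trivial beyond it. The coordinate [0] is
    left out so that the same bound serves to recognise elements concentrated at
    the origin. *)
Variable beta : seq nat -> nat.
Hypothesis betaC : computable beta.
Hypothesis size_beta : forall u, size u <= beta u.
Hypothesis beta_hi : forall u,
  (forall n, (0 < n <= Posz (beta u))%R -> base (eval wreath_gen u) n = 1) ->
  forall n, (Posz (beta u) < n)%R -> base (eval wreath_gen u) n = 1.

Let beta_lo u n : (n < - Posz (beta u))%R -> base (eval wreath_gen u) n = 1.
Proof. by move=> ltn; apply: base_eval_neg; have := size_beta u; lia. Qed.

Definition window_word (u : seq nat) (i : nat) : seq nat :=
  (trace (Posz i - Posz (beta u))%R u).2.

Lemma window_wordE u i :
  eval x (window_word u i) = base (eval wreath_gen u) (Posz i - Posz (beta u))%R.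
Proof. exact: trace_base. Qed.

Lemma computable_window_word E (eE : encoding E) (u : E -> seq nat) (i : E -> nat) :
  computable u -> computable i -> computable (fun e => window_word (u e) (i e)).
Proof.
move=> uC iC; apply/computable_snd/computable_trace => //.
by apply: computable_int_sub iC _; apply: (computable_comp betaC).
Qed.

Definition in_window (u : seq nat) (n : int) : bool :=
  (- Posz (beta u) <= n <= Posz (beta u))%R.

Lemma in_windowP u n :
  reflect (exists2 i, i \in iota 0 (beta u).*2.+1 & n = (Posz i - Posz (beta u))%R)
    (in_window u n).
Proof.
rewrite /in_window; apply: (iffP idP) => [n_in|[i]]; last by rewrite mem_iota => ? ->; lia.
by exists (absz (n + Posz (beta u))%R); rewrite ?mem_iota; lia.
Qed.

Section Decision.
Variables (k : order_kind) (P : pred A).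
Hypothesis coneP : is_cone k P.
Variable p : seq nat -> bool.
Hypothesis pC : computable p.
Hypothesis pE : forall w, P (eval x w) <-> p w.

(** An element is trivial when it and its inverse belong to the cone. *)
Let is1 (w : seq nat) : bool := p w && p (inv_letters w).

Lemma is1P w : reflect (eval x w = 1) (is1 w).
Proof.
have [[P1 PV _ _] _] := coneP.
apply: (iffP andP) => [[/pE Pw /pE]|w1]; first by rewrite eval_inv; apply: PV.
by split; apply/pE; rewrite ?eval_inv w1 ?invg1.
Qed.

Lemma computable_is1 E (eE : encoding E) (w : E -> seq nat) :
  computable w -> computable (fun e => is1 (w e)).
Proof.
move=> wC; apply: computable_and; first exact: (computable_comp pC).
exact/(computable_comp pC)/computable_inv.
Qed.

(** Inside the window the definition of the cone is checked literally; outside it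
    there is nothing to check, by [beta_lo] and [beta_hi]. *)
Lemma wreath_cone_decidable : word_decidable wreath_gen (wreath_cone P).
Proof.
pose one_below i u := all (fun j => is1 (window_word u j)) (iota 0 i).
pose q u := (0 < (trace 0 u).1)%R || ((trace 0 u).1 == 0%R) &&
  all (fun i => one_below i u ==> p (window_word u i)) (iota 0 (beta u).*2.+1).
have trC : computable (fun u => (trace 0 u).1).
  by apply/computable_fst/computable_trace; computable_tac.
exists q.
  apply: computable_or; first exact: computable_int_gt0.
  apply: computable_and; first exact: computable_int_eq0.
  apply: (computable_all_below
    (p := fun e => one_below e.1 e.2 ==> p (window_word e.2 e.1))).
    by computable_tac.
  apply: computable_imp.
    apply: (computable_all_below (p := fun e => is1 (window_word e.2.2 e.1))).
      by computable_tac.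
    by apply/computable_is1/computable_window_word; computable_tac.
  by apply/(computable_comp pC)/computable_window_word; computable_tac.
have [[P1 _ _ _] _] := coneP.
move=> u; rewrite /q trace_shift add0r.
set g := eval wreath_gen u; have gE i := window_wordE u i.
have qE i : reflect (forall j, (j < i)%N -> base g (Posz j - Posz (beta u))%R = 1)
    (one_below i u).
  apply: (iffP allP) => q1 j; last by rewrite mem_iota => /q1 gj; apply/is1P; rewrite gE.
  by move=> ltji; rewrite -gE; apply/is1P; apply: (q1 j); rewrite mem_iota.
split=> [/asboolP[-> //|[g0 Pg]]|/orP[|/andP[/eqP g0 /allP Pg]]].
- apply/orP; right; rewrite g0 eqxx andTb; apply/allP => i _; apply/implyP => /qE g1.
  apply/pE; rewrite gE; apply: Pg => m ltm.
  have [lo|hi] := ltP m (- Posz (beta u))%R; first exact: beta_lo.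
  have -> : m = (Posz (absz (m + Posz (beta u))%R) - Posz (beta u))%R by lia.
  by apply: g1; lia.
- by move=> g_gt0; apply/asboolP; left.
apply/asboolP; right; split=> // n g1.
have [/in_windowP[i i_in n_def]|n_out] := boolP (in_window u n).
  have /implyP := Pg i i_in; rewrite n_def -gE => /(_ _)/pE; apply.
  by apply/qE => j ltji; apply: g1; lia.
suff -> : base g n = 1 by [].
have [lo|hi] := ltP n (- Posz (beta u))%R; first exact: beta_lo.
move: n_out; rewrite /in_window hi /= -ltNge => n_hi.
by apply: (beta_hi _ n_hi) => m m_in; apply: g1; lia.
Qed.

Lemma at_origin_decidable (Q : A -> Prop) :
  word_decidable x Q ->
  word_decidable wreath_gen (at_origin Q).
Proof.
move=> [q qC qE].
pose r u := ((trace 0 u).1 == 0%R) &&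
  (all (fun i => (i == beta u) || is1 (window_word u i)) (iota 0 (beta u).*2.+1) &&
   q (trace 0 u).2).
have trC : computable (trace 0) by apply: computable_trace; computable_tac.
exists r.
  apply: computable_and; first exact/computable_int_eq0/computable_fst.
  apply: computable_and; last exact/(computable_comp qC)/computable_snd.
  apply: (computable_all_below
    (p := fun e => (e.1 == beta e.2) || is1 (window_word e.2 e.1))).
    by computable_tac.
  apply: computable_or; last first.
    by apply/computable_is1/computable_window_word; computable_tac.
  by apply: computable_eqn; [|apply: (computable_comp betaC)]; computable_tac.
move=> u; rewrite /r trace_shift add0r.
set g := eval wreath_gen u; have gE i := window_wordE u i.
split=> [[-> g1 Qg]|/and3P[/eqP g0 /allP g1 Qg]].
  rewrite eqxx andTb; apply/andP; split; last by apply/qE; rewrite trace_base.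
  apply/allP => i _; case: eqVneq => //= ne_i; apply/is1P; rewrite gE.
  by apply: g1; lia.
have win n : in_window u n -> n <> 0%R -> base g n = 1.
  case/in_windowP=> i /g1 /orP[/eqP ->|/is1P]; first by lia.
  by rewrite gE => ? ->.
split=> // [n n0|]; last by move/qE: Qg; rewrite trace_base.
have [/win -> //|n_out] := boolP (in_window u n).
have [lo|hi] := ltP n (- Posz (beta u))%R; first exact: beta_lo.
move: n_out; rewrite /in_window hi /= -ltNge => n_hi.
apply: (beta_hi _ n_hi) => m m_in; apply: win; last by lia.
by rewrite /in_window; lia.
Qed.

End Decision.
End WreathWords.

(** * First layer: rays *)

Section Rays.
Variables (A : groupType) (x : nat -> A).

(** The ray of index [j] is constant, equal to [x j], on the non-negative
    coordinates. *)
Definition ray_word (p : nat * nat) : seq nat := [:: p.1.*2].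

Definition ray_gen : nat -> wreath A := wreath_gen x ray_word.

Lemma coordinate_ray j n : (0 <= n)%R -> coordinate x ray_word j n = x j.
Proof. by case: n => // n _; rewrite /coordinate eval_seq1 eval_double. Qed.

(** Far to the right the rays are invariant under translation, so the coordinates
    of a word are eventually constant. *)
Lemma base_ray_const u m n :
  (Posz (size u) < m)%R -> (Posz (size u) < n)%R ->
  base (eval ray_gen u) m = base (eval ray_gen u) n.
Proof.
elim: u m n => [|l u IHu] m n /= ltm ltn; first by rewrite eval_nil.
rewrite !base_eval_cons !base_letter shift_letter !coordinate_ray; try by lia.
by congr (_ * _); apply: IHu; do 2?case: ifP; lia.
Qed.

Lemma computable_ray_word : computable ray_word.
Proof. by rewrite /ray_word; computable_tac. Qed.

Definition ray_window (u : seq nat) : nat := (size u).+1.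

Lemma computable_ray_window : computable ray_window.
Proof. exact/computable_succ/computable_size/computable_id. Qed.

Lemma base_ray_window u :
  (forall n, (0 < n <= Posz (ray_window u))%R -> base (eval ray_gen u) n = 1) ->
  forall n, (Posz (ray_window u) < n)%R -> base (eval ray_gen u) n = 1.
Proof.
move=> u1 n ltn; rewrite (@base_ray_const u n (Posz (ray_window u))).
- by apply: u1; rewrite /ray_window; lia.
- by rewrite /ray_window in ltn *; lia.
by rewrite /ray_window; lia.
Qed.

End Rays.

(** * Second layer: sparse spikes *)

Section Hits.
Variables (A : groupType) (x : nat -> A) (B : nat * nat -> seq nat).

(** Signs of those letters of a word which, when the word is evaluated at
    coordinate [n], read the function of index [0] at the coordinate [n + d].
    They depend on [d] only, not on [n]. *)
Fixpoint hits (u : seq nat) (d : int) : seq bool :=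
  if u is l :: u' then
    if odd l./2 then hits u' (if odd l then (d + 1)%R else (d - 1)%R)
    else if (l./2./2 == 0%N) && (d == 0%R) then odd l :: hits u' d else hits u' d
  else [::].

Definition signed_power (v : A) (s : seq bool) : A :=
  \prod_(b <- s) (if b then v^-1 else v).

Lemma signed_powerE v s :
  signed_power v s = v ^+ count negb s * (v ^+ count id s)^-1.
Proof.
rewrite /signed_power; elim: s => [|b s IHs].
  by rewrite big_nil /= invg1 mulg1.
rewrite big_cons IHs; case: b => /=; rewrite ?add0n ?add1n.
  have vc : commute v^-1 (v ^+ count negb s).
    by apply: commuteX; apply/commute_sym/commuteV/commute_refl.
  by rewrite mulgA vc -mulgA expgSr invgM.
by rewrite expgS mulgA.
Qed.

Lemma signed_power_balanced v s : count negb s = count id s -> signed_power v s = 1.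
Proof. by move=> s0; rewrite signed_powerE s0 mulgV. Qed.

(** If a single coordinate [q] in reach of [n] carries a nontrivial value [v],
    then the word evaluates at [n] to a power of [v]. *)
Lemma base_eval_spike u n q v :
  (forall m, (n - Posz (size u) <= m <= n + Posz (size u))%R ->
     coordinate x B 0 m = (if m == q then v else 1) /\
     forall j, coordinate x B j.+1 m = 1) ->
  base (eval (wreath_gen x B) u) n = signed_power v (hits u (q - n)%R).
Proof.
elim: u n => [|l u IHu] n /= spike; first by rewrite eval_nil /signed_power big_nil.
rewrite base_eval_cons IHu => [|m m_in]; last first.
  by apply: spike; move: m_in; rewrite shift_letter; do 2?case: ifP; lia.
rewrite base_letter shift_letter; case: ifP => _; rewrite ?mul1g ?addr0.
  by congr (signed_power _ (hits _ _)); case: ifP => _; lia.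
have [c0 cS] := spike n ltac:(lia).
case: (l./2./2) => [|j] /=; last by rewrite cS invg1 if_same mul1g.
rewrite c0 subr_eq0 [q == n]eq_sym; case: eqP => _.
  by rewrite /signed_power big_cons.
by rewrite invg1 if_same mul1g.
Qed.

End Hits.

(** The translation has infinite order, hence detects the exponent sum. *)
Lemma shift_signed_power (A : groupType) (s : seq bool) :
  signed_power (wreath_shift A) s = 1 -> count negb s = count id s.
Proof.
rewrite signed_powerE => /(congr1 (@shift A)).
by rewrite shiftM shiftV !shift_shiftX shift1; lia.
Qed.

Section Spikes.
Variables (A : groupType) (x : nat -> A).
Notation y := (ray_gen x).

(** The function of index [0] carries the value [y i] at the coordinate [2 ^ i],
    the code of the one-element list [i]; the function of index [1] carries the
    translation of the first layer, [y 1], at the origin. *)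
Definition spike_word (p : nat * nat) : seq nat :=
  if p.1 == 0%N then
    if size (CodeSeq.decode p.2) == 1%N
    then [:: (head 0%N (CodeSeq.decode p.2)).*2] else [::]
  else if (p.1 == 1%N) && (p.2 == 0%N) then [:: 1.*2] else [::].

Definition spike_gen : nat -> wreath (wreath A) := wreath_gen y spike_word.

Lemma coordinate_spike i : coordinate y spike_word 0 (Posz (2 ^ i)%N) = y i.
Proof.
rewrite /coordinate /= /spike_word /=.
have -> : (2 ^ i)%N = CodeSeq.code [:: i] by rewrite /= muln1.
by rewrite CodeSeq.codeK /= eval_seq1 eval_double.
Qed.

Lemma coordinate_spike1 n :
  (forall i, n <> Posz (2 ^ i)%N) -> coordinate y spike_word 0 n = 1.
Proof.
case: n => n n2; last exact: eval_nil.
rewrite /coordinate /= /spike_word /=.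
case Ds: (CodeSeq.decode n) => [|i [|j s]] /=; try exact: eval_nil.
by case: (n2 i); rewrite -[n]CodeSeq.decodeK Ds /= muln1.
Qed.

Lemma coordinate_delta n :
  coordinate y spike_word 1 n = if n == 0%R then wreath_shift A else 1.
Proof.
by case: n => [[|n]|n]; rewrite /coordinate /= ?eval_nil // eval_seq1 eval_double.
Qed.

Lemma coordinate_none j n : coordinate y spike_word j.+2 n = 1.
Proof. by case: n => n; rewrite /coordinate /= eval_nil. Qed.

Lemma computable_spike_word : computable spike_word.
Proof.
have sizeC : computable (fun p : nat * nat => size (CodeSeq.decode p.2)).
  by apply: computable_size; computable_tac.
have headC : computable (fun p : nat * nat => head 0%N (CodeSeq.decode p.2)).
  apply: computable_ext (computable_case_seq (f := fun p => CodeSeq.decode p.2)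
    (g := fun=> 0%N) (h := fun z => z.2.1) _ _ _) _; by computable_tac.
by rewrite /spike_word; computable_tac.
Qed.

(** The exponent is odd, so that the spike at the power of two carries the
    translation; its size guarantees that from this spike on the gaps between
    spikes exceed twice the length of the word. *)
Definition spike_window (u : seq nat) : nat := (2 ^ (size u).*2.+3 + size u)%N.

Lemma size_spike_window u : size u <= spike_window u.
Proof. by rewrite /spike_window leq_addl. Qed.

Lemma computable_spike_window : computable spike_window.
Proof.
have sizeC : computable (fun u : seq nat => size u).
  exact/computable_size/computable_id.
by rewrite /spike_window; computable_tac.
Qed.

Lemma pow2_gap N i j :
  (N.*2.+3 <= i)%N -> (2 ^ i <= 2 ^ j + N.*2)%N -> (2 ^ j <= 2 ^ i + N.*2)%N -> i = j.
Proof.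
case: i => // i leNi; rewrite expnS => le_ij le_ji.
have i_lt : (i < 2 ^ i)%N by apply: ltn_expl.
have [lt_ij|lt_ji|//] := ltngtP i.+1 j.
  have : (2 ^ i.+2 <= 2 ^ j)%N by rewrite leq_exp2l.
  by rewrite !expnS; lia.
have : (2 ^ j <= 2 ^ i)%N by rewrite leq_exp2l.
by lia.
Qed.

Lemma base_spike_near u n i :
  (size u).*2.+3 <= i -> (`|Posz (2 ^ i)%N - n| <= Posz (size u))%R ->
  base (eval spike_gen u) n = signed_power (y i) (hits u (Posz (2 ^ i)%N - n)%R).
Proof.
move=> lei near_n; have i_lt : (i < 2 ^ i)%N by apply: ltn_expl.
apply: base_eval_spike => m m_in; split=> [|[|j]].
- case: eqP => [->|ne_mi]; first exact: coordinate_spike.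
  apply: coordinate_spike1 => j m_def; apply: ne_mi.
  by rewrite m_def (@pow2_gap (size u) i j) //; lia.
- by rewrite coordinate_delta; case: eqP => // m0; lia.
exact: coordinate_none.
Qed.

(** Far to the right at most one spike is in reach, and a word evaluates to a
    power of its value whose exponent depends only on the distance to the spike.
    Inside the window all relevant distances already occur around a spike with
    value [t], where triviality forces the exponent to vanish. *)
Lemma base_spike_window u :
  (forall n, (0 < n <= Posz (spike_window u))%R -> base (eval spike_gen u) n = 1) ->
  forall n, (Posz (spike_window u) < n)%R -> base (eval spike_gen u) n = 1.
Proof.
move=> u1; pose i0 := (size u).*2.+3.
have i0_lt : (i0 < 2 ^ i0)%N by apply: ltn_expl.
have balanced d : (`|d| <= Posz (size u))%R ->
    count negb (hits u d) = count id (hits u d).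
  move=> led; apply: (@shift_signed_power A).
  have -> : wreath_shift A = y i0 by rewrite /ray_gen /wreath_gen /= odd_double.
  have -> : d = (Posz (2 ^ i0)%N - (Posz (2 ^ i0)%N - d))%R by lia.
  rewrite -base_spike_near ?leqnn //; last by lia.
  by apply: u1; rewrite /spike_window -/i0; lia.
move=> n; rewrite /spike_window -/i0 => ltn.
have [[i near_i]|far] := pselect (exists i, (`|Posz (2 ^ i)%N - n| <= Posz (size u))%R).
  have lt_i0i : i0 < i by rewrite -(ltn_exp2l _ _ (isT : 1 < 2)); lia.
  by rewrite (base_spike_near (ltnW lt_i0i)) // signed_power_balanced ?balanced.
rewrite /spike_gen (@base_eval_spike _ _ _ u n 0%R 1) => [|m m_in].
  by rewrite /signed_power big1 // => b _; rewrite invg1 if_same.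
split=> [|[|j]]; last exact: coordinate_none.
  rewrite if_same; apply: coordinate_spike1 => i m_def; apply: far; exists i; lia.
by rewrite coordinate_delta; case: eqP => // m0; lia.
Qed.

End Spikes.

(** * Copies of the base group at the origin *)

Section Delta.
Variable A : groupType.
Implicit Types (a : A) (g : wreath A).

Lemma delta_bounded a : bounded_below (fun n : int => if n == 0%R then a else 1).
Proof. by exists 0%R => n lt_n0; case: eqP => // n0; lia. Qed.

Definition delta a : wreath A := wreath_base (delta_bounded a).

Lemma base_delta a n : base (delta a) n = if n == 0%R then a else 1.
Proof. by []. Qed.

Lemma deltaM a b : delta (a * b) = delta a * delta b.
Proof.
apply: wreath_eq => [n|//]; rewrite baseM !base_delta addr0.
by case: eqP => // _; rewrite mulg1.
Qed.

Lemma delta1 : delta 1 = 1.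
Proof. by apply: wreath_eq => [n|//]; rewrite base_delta if_same. Qed.

HB.instance Definition _ := isUMagmaMorphism.Build A (wreath A) delta (delta1, deltaM).

Lemma delta_inj : injective delta.
Proof. by move=> a b /(congr1 (fun g => base g 0%R)); rewrite !base_delta. Qed.

Lemma at_originP Q g : at_origin Q g <-> exists2 a, Q a & g = delta a.
Proof.
split=> [[g0 g1 Qg]|[a Qa ->]].
  exists (base g 0%R) => //; apply: wreath_eq => // n.
  by rewrite base_delta; case: eqP => [->|/g1].
by split=> // n /eqP/negPf n0; rewrite base_delta n0.
Qed.

Lemma deltaJ a h : shift h = 0%R -> delta a ^ h = delta (a ^ base h 0%R).
Proof.
move=> h0; apply: wreath_eq => [n|]; last by rewrite shiftJ.
rewrite baseJ // h0 subr0 !base_delta.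
by case: eqP => [->|_] //; rewrite conj1g.
Qed.

Lemma wreath_cone_delta k (P : pred A) a :
  is_cone k P -> wreath_cone P (delta a) = P a.
Proof.
move=> [[P1 _ _ _] _]; apply/asboolP/idP => [[//|[_ /(_ 0%R)]]|Pa].
  by rewrite base_delta eqxx; apply=> m; rewrite base_delta; case: eqP => // ->; lia.
by right; split=> // n _; rewrite base_delta; case: ifP.
Qed.

End Delta.

Section Isolation.
Variables (A : groupType) (x : nat -> A).

(** The quotient of a ray by its translate is concentrated at the origin. *)
Lemma ray_isolation i : [~ wreath_shift A, ray_gen x i.*2] = delta (x i).
Proof.
rewrite /ray_gen /wreath_gen odd_double doubleK commgEr; set f := wreath_base _.
have f0 : shift f = 0%R by [].
have fV0 : shift f^-1 = 0%R by rewrite shiftV f0 oppr0.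
apply: wreath_eq => [n|]; last by rewrite shiftM shiftJ fV0 f0.
rewrite baseM shiftJ fV0 addr0 baseJ // base_shift conjg1 shift_shift baseV f0 subr0.
rewrite base_delta /f !base_base; have [lt_n0|gt_n0|->] := ltgtP n 0%R.
- by rewrite !coordinate_neg ?invg1 ?mulg1 //; lia.
- by rewrite !coordinate_ray ?mulVg //; lia.
by rewrite [coordinate _ _ _ (0 - 1)%R]coordinate_neg // coordinate_ray // invg1 mul1g.
Qed.

(** Translated by [2 ^ 2i], the spikes meet the function concentrated at the
    origin only there, and with the value [y (2 i)]; hence so does the
    commutator. *)
Lemma spike_isolation i :
  [~ spike_gen x 2, spike_gen x 0 ^ (spike_gen x 1 ^- (2 ^ i.*2)%N)] =
  delta [~ wreath_shift A, ray_gen x i.*2].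
Proof.
set q := (2 ^ i.*2)%N; rewrite /spike_gen; set a := wreath_gen _ _ 0.
have -> : wreath_gen (ray_gen x) spike_word 1 = wreath_shift _ by [].
have -> : wreath_gen (ray_gen x) spike_word 2 = delta (wreath_shift A).
  apply: wreath_eq => // n; rewrite base_delta /wreath_gen /=.
  by rewrite base_base coordinate_delta.
have a0 : shift a = 0%R by [].
have aq0 : shift (a ^ (wreath_shift (wreath A) ^- q)) = 0%R by rewrite shiftJ.
rewrite commgEl deltaJ // -gmulfV -deltaM; congr delta.
rewrite baseJ // baseV base_shiftX invg1 conjg1 shiftV shift_shiftX.
by rewrite add0r opprK /a /wreath_gen /= base_base coordinate_spike.
Qed.

End Isolation.

(** * Finitely generated subgroups *)

Section Generated.
Variables (G : groupType) (I : Type) (x : I -> G).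

Definition generated_pred : pred G := fun g => `[< exists w, word_value x w = g >].

Lemma word_value_cat u v : word_value x (u ++ v) = word_value x u * word_value x v.
Proof. exact: big_cat. Qed.

Lemma word_value_seq1 i : word_value x [:: (i, false)] = x i.
Proof. exact: big_seq1. Qed.

Definition word_inv (w : word I) : word I := rev [seq (l.1, ~~ l.2) | l <- w].

Lemma word_value_inv w : word_value x (word_inv w) = (word_value x w)^-1.
Proof.
elim: w => [|[i b] w IHw]; first by rewrite /word_value !big_nil invg1.
rewrite /word_inv /= rev_cons -cats1 word_value_cat IHw.
rewrite /word_value big_seq1 big_cons invgM; congr (_ * _).
by case: b; rewrite ?invgK.
Qed.

Lemma generated_closed : group_closed generated_pred.
Proof.
split=> [|_ _ /asboolP[u <-] /asboolP[v <-]]; apply/asboolP.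
  by exists [::]; apply: big_nil.
by exists (u ++ word_inv v); rewrite word_value_cat word_value_inv.
Qed.

Lemma generated_gen i : generated_pred (x i).
Proof. by apply/asboolP; exists [:: (i, false)]; apply: word_value_seq1. Qed.

Definition generated : Type := {g : G | generated_pred g}.

HB.instance Definition _ := SubChoice.copy generated {g : G | generated_pred g}.
HB.instance Definition _ :=
  SubChoice_isSubGroup.Build G generated_pred generated generated_closed.

Lemma val_generatedV (g : generated) : val g^-1 = (val g)^-1.
Proof. exact: gmulfV. Qed.

Lemma val_generatedJ (g h : generated) : val (g ^ h) = val g ^ val h.
Proof. by rewrite !valM val_generatedV. Qed.

Definition generator (i : I) : generated := exist _ (x i) (generated_gen i).

Lemma val_word_generator w : val (word_value generator w) = word_value x w.
Proof.
rewrite /word_value; elim: w => [|[i b] w IHw]; first by rewrite !big_nil val1.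
by rewrite !big_cons valM IHw; congr (_ * _); case: b.
Qed.

Lemma generates_generator : generates generator.
Proof.
move=> g; have /asboolP[w xw] := valP g; exists w.
by apply: val_inj; rewrite val_word_generator xw.
Qed.

End Generated.

Lemma group_closed_word (G : groupType) (S : {pred G}) (I : Type) (x : I -> G) w :
  group_closed S -> (forall i, x i \in S) -> word_value x w \in S.
Proof.
move=> SG Sx; rewrite /word_value; elim: w => [|[i b] w IHw].
  by rewrite big_nil; case: SG.
rewrite big_cons; apply: (group_closedM SG) => //.
by case: b => //=; apply: (group_closedV SG).
Qed.

Lemma group_closedX (G : groupType) (S : {pred G}) g n :
  group_closed S -> g \in S -> g ^+ n \in S.
Proof.
move=> SG Sg; elim: n => [|n IHn]; first by case: SG.
by rewrite expgS (group_closedM SG).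
Qed.

Lemma group_closedR (G : groupType) (S : {pred G}) g h :
  group_closed S -> g \in S -> h \in S -> g ^ h \in S /\ [~ g, h] \in S.
Proof.
move=> SG Sg Sh; have [SM SV] := (group_closedM SG, group_closedV SG).
have Sgh : g ^ h \in S by exact: SM _ _ (SV _ Sh) (SM _ _ Sg Sh).
by split=> //; exact: SM _ _ (SV _ Sg) Sgh.
Qed.

(** * The overgroup *)

Section Embedding.
Variables (k : order_kind) (H : groupType) (x : nat -> H) (leH : rel H).
Hypothesis leH_order : is_order k leH.
Hypothesis x_generates : generates x.
Hypothesis leH_computable : computable_wrt id x leH.

Let P : pred H := leH 1.
Let P1 : pred (wreath H) := wreath_cone P.
Let P2 : pred (wreath (wreath H)) := wreath_cone P1.

Let coneP : is_cone k P := (is_order_cone leH_order).1.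
Let coneP1 : is_cone k P1 := wreath_cone_is_cone coneP.
Let coneP2 : is_cone k P2 := wreath_cone_is_cone coneP1.

Lemma eval_letters_id w : eval x (letters id w) = word_value x w.
Proof. exact: eval_letters. Qed.

Definition word_of (u : seq nat) : word nat := [seq (l./2, odd l) | l <- u].

Lemma letters_word_of u : letters id (word_of u) = u.
Proof.
rewrite /letters -map_comp; elim: u => //= l u ->; congr cons.
by rewrite addnC odd_double_half.
Qed.

Lemma group_cone_decidable : word_decidable x P.
Proof.
have [p pC pE] := recursive_word_pairsE leH_computable.
exists (fun u => p ([::], u)).
  apply: (computable_comp pC).
  exact: computable_pair (computable_const _) computable_id.
move=> u; have := pE [::] (word_of u); rewrite letters_word_of.
by rewrite -(eval_letters_id (word_of u)) letters_word_of /word_value big_nil.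
Qed.

Lemma ray_cone_decidable : word_decidable (ray_gen x) P1.
Proof.
have [p pC pE] := group_cone_decidable.
apply: (wreath_cone_decidable computable_ray_word computable_ray_window _ _
  coneP pC pE) => [u|]; [exact: leqnSn | exact: base_ray_window].
Qed.

Lemma ray_origin_decidable : word_decidable (ray_gen x) (at_origin (fun _ : H => True)).
Proof.
have [p pC pE] := group_cone_decidable.
apply: (at_origin_decidable computable_ray_word computable_ray_window _ _
  coneP pC pE) => [u||]; [exact: leqnSn | exact: base_ray_window|].
by exists (fun=> true); first exact: computable_const.
Qed.

Lemma spike_cone_decidable : word_decidable (spike_gen x) P2.
Proof.
have [p pC pE] := ray_cone_decidable.
exact: (wreath_cone_decidable computable_spike_word computable_spike_window
  (@size_spike_window) (@base_spike_window _ x) coneP1 pC pE).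
Qed.

Lemma spike_origin_decidable :
  word_decidable (spike_gen x) (at_origin (at_origin (fun _ : H => True))).
Proof.
have [p pC pE] := ray_cone_decidable.
exact: (at_origin_decidable computable_spike_word computable_spike_window
  (@size_spike_window) (@base_spike_window _ x) coneP1 pC pE ray_origin_decidable).
Qed.

Definition overgroup_gen (i : 'I_3) : wreath (wreath H) := spike_gen x i.
Notation G := (generated overgroup_gen).

(** Two nested commutators isolate each [x i], and the group contains the product
    of isolated elements. *)
Lemma generated_delta h : generated_pred overgroup_gen (delta (delta h)).
Proof.
have SG := generated_closed overgroup_gen.
have Sz i : (i < 3)%N -> spike_gen x i \in generated_pred overgroup_gen.
  by move=> lti; apply: (generated_gen overgroup_gen (Ordinal lti)).
have [w <-] := x_generates h.
have -> : delta (delta (word_value x w)) =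
    word_value (fun i => delta (delta (x i))) w.
  rewrite /word_value !gmulf_prod; apply: eq_bigr => -[i b] _ /=.
  by case: b; rewrite ?gmulfV.
apply: (group_closed_word _ SG) => i; rewrite -ray_isolation -spike_isolation.
apply: (group_closedR SG (Sz 2%N isT) _).2.
apply: (group_closedR SG (Sz 0%N isT) _).1.
by apply: (group_closedV SG); apply: group_closedX SG (Sz 1%N isT).
Qed.

Definition embed (h : H) : G := exist _ (delta (delta h)) (generated_delta h).

Lemma embedM : {morph embed : h h' / h * h'}.
Proof. by move=> h h'; apply: val_inj; rewrite valM /= !deltaM. Qed.

HB.instance Definition _ := isMultiplicative.Build H G embed embedM.

Definition overgroup_cone : pred G := fun g => P2 (val g).
Definition overgroup_order : rel G := cone_order overgroup_cone.

Lemma overgroup_is_order : is_order k overgroup_order.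
Proof.
have [[P2_1 P2V P2M P2T] P2J] := coneP2.
apply: cone_order_is_order; split; first split; rewrite /overgroup_cone.
- by rewrite val1.
- by move=> g Pg; rewrite val_generatedV => /(P2V _ Pg) g1; apply: val_inj; rewrite g1 val1.
- by move=> g h Pg Ph; rewrite valM; apply: P2M.
- by move=> g; rewrite val_generatedV.
by move=> kB g h Pg; rewrite val_generatedJ; apply: P2J.
Qed.

Lemma embed_order h h' : overgroup_order (embed h) (embed h') = leH h h'.
Proof.
rewrite /overgroup_order /cone_order /overgroup_cone valM val_generatedV /=.
rewrite -!gmulfV -!gmulfM /P2 (wreath_cone_delta _ coneP1).
by rewrite /P1 (wreath_cone_delta _ coneP) [RHS](is_order_cone leH_order).2.
Qed.

Lemma val_word w :
  val (word_value (generator overgroup_gen) w) =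
  eval (spike_gen x) (letters (@nat_of_ord 3) w).
Proof. by rewrite val_word_generator eval_letters. Qed.

Lemma in_image_embed (g : G) :
  in_image embed g <-> at_origin (at_origin (fun _ : H => True)) (val g).
Proof.
split=> [[h <-]|/at_originP[f /at_originP[h _ ->] g_def]].
  by apply/at_originP; exists (delta h) => //; apply/at_originP; exists h.
by exists h; apply: val_inj.
Qed.

Lemma embed_computable_overgroup : computable_overgroup k embed overgroup_order.
Proof.
split; first by move=> h h' /(congr1 val) /delta_inj /delta_inj.
  exact: overgroup_is_order.
exists 3, (generator overgroup_gen); split; first exact: generates_generator.
  have [p pC pE] := spike_cone_decidable.
  apply: (recursive_word_pairsI (p := fun w => p (inv_letters w.1 ++ w.2))).
    apply: (computable_comp pC); apply: computable_cat; last by computable_tac.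
    by apply: computable_inv; computable_tac.
  move=> u v; rewrite -pE /overgroup_order /cone_order /overgroup_cone.
  by rewrite valM val_generatedV !val_word eval_cat eval_inv.
have [p pC pE] := spike_origin_decidable; apply: (recursive_wordsI pC) => w.
by rewrite -pE -val_word; apply: in_image_embed.
Qed.

(** Conjugation by an element without translation acts on each coordinate
    separately, by an inner automorphism of the base group. Hence the copy at the
    origin is preserved as long as the translations of both layers are trivial. *)
Definition subnormal_series (i : nat) (g : G) : Prop :=
  match i with
  | 0%N => in_image embed g
  | 1%N => shift (val g) = 0%R /\ forall n, shift (base (val g) n) = 0%R
  | 2%N => shift (val g) = 0%R
  | _ => True
  end.

Lemma embedJ h g :
  subnormal_series 1 g -> embed h ^ g = embed (h ^ base (base (val g) 0%R) 0%R).
Proof.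
by move=> [g0 g1]; apply: val_inj; rewrite val_generatedJ /= !deltaJ.
Qed.

Lemma embed_subnormal : subnormal (in_image embed).
Proof.
exists 3, subnormal_series; split=> // [i lei|i lti].
  case: i lei => [|[|[|[|i]]]] //= _; split=> //.
  - by exists 1; apply: val_inj; rewrite val1 /= !delta1.
  - by move=> _ _ [h <-] [h' <-]; exists (h * h'); rewrite gmulfM.
  - by move=> _ [h <-]; exists h^-1; apply: val_inj; rewrite val_generatedV /= !gmulfV.
  - move=> g h [g0 g1] [h0 h1]; rewrite /subnormal_series valM.
    by split=> [|n]; rewrite ?baseM shiftM ?g0 ?g1 ?h0 ?h1.
  - move=> g [g0 g1]; rewrite /subnormal_series val_generatedV.
    by split=> [|n]; rewrite ?baseV shiftV ?g0 ?g1.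
  - by rewrite /subnormal_series => g h g0 h0; rewrite valM shiftM g0 h0.
  by rewrite /subnormal_series => g g0; rewrite val_generatedV shiftV g0.
case: i lti => [|[|[|i]]] //= _; split=> //.
- by move=> _ [h <-]; split=> [|n]; rewrite //= base_delta; case: ifP.
- by move=> _ g [h <-] g1; rewrite embedJ //; eexists.
- by move=> g [].
- move=> g h [g0 g1] h0; rewrite /subnormal_series val_generatedJ.
  by split=> [|n]; rewrite ?baseJ // shiftJ.
by rewrite /subnormal_series => g h g0 _; rewrite val_generatedJ shiftJ.
Qed.

End Embedding.

Lemma finitely_generated_overgroup k (H : groupType) (leH : rel H) n (x : 'I_n -> H) :
  is_order k leH -> generates x -> computable_wrt (@nat_of_ord n) x leH ->
  computable_overgroup k (idfun : {multiplicative H -> H}) leH /\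
  subnormal (in_image (idfun : {multiplicative H -> H})).
Proof.
move=> leO x_generates leC.
have all_in g : in_image (idfun : {multiplicative H -> H}) g by exists g.
split; last first.
  by exists 0%N, (fun _ _ => True); split=> // g; split.
split=> //; exists n, x; split=> //.
by apply: (recursive_wordsI (p := fun=> true)) => //; apply: computable_const.
Qed.

Lemma computable_order_overgroup k (H : groupType) (leH : rel H) :
  computable_order k leH ->
  exists (G : groupType) (phi : {multiplicative H -> G}) (leG : rel G),
    [/\ computable_overgroup k phi leG, subnormal (in_image phi)
      & forall x y : H, leG (phi x) (phi y) = leH x y].
Proof.
(* A finitely generated group is its own overgroup. *)
move=> [leO [[n [x [x_generates leC]]]|[x [x_generates leC]]]].
  have [GC sub] := finitely_generated_overgroup leO x_generates leC.
  by exists H, idfun, leH.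
exists (generated (overgroup_gen x)), (embed x_generates), (@overgroup_order _ x leH); split.
- exact: embed_computable_overgroup.
- exact: embed_subnormal.
by move=> y z; apply: (embed_order leO).
Qed.

(** * Computable orders on decidable subgroups *)

Section Subgroup.
Variables (k : order_kind) (H G : groupType) (phi : {multiplicative H -> G}).
Variable leG : rel G.
Hypothesis phi_inj : injective phi.
Hypothesis leG_order : is_order k leG.

Lemma restricted_order : is_order k (fun x y : H => leG (phi x) (phi y)).
Proof.
have leftH : left_order leG -> left_order (fun x y : H => leG (phi x) (phi y)).
  move=> [[leR leA leT leTot] leM]; split; first split=> [x|x y|y x z|x y] //.
  - by move/leA/phi_inj.
  - exact: leT.
  by move=> a x y lexy; rewrite !gmulfM leM.
case: k leG_order => /= [|[leL leMr]]; first exact: leftH.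
by split; [exact: leftH | move=> a x y lexy; rewrite !gmulfM leMr].
Qed.

Lemma morph1 : phi 1 = 1.
Proof. by apply: (mulgI (phi 1)); rewrite -gmulfM !mulg1. Qed.

Lemma morphV h : phi h^-1 = (phi h)^-1.
Proof. by apply/eqP; rewrite -mulg_eq1 -gmulfM mulVg morph1. Qed.

Variables (n : nat) (s : 'I_n -> G).
Hypothesis s_gen : generates s.
Hypothesis leC : computable_wrt (@nat_of_ord n) s leG.
Hypothesis memC :
  recursive_words (@nat_of_ord n) (fun w => in_image phi (word_value s w)).

(** The value of [extend_gen] outside the range is a dummy: only words passing
    [in_range] are evaluated. *)
Definition extend_gen (i : nat) : G := if insub i is Some j then s j else 1.

Definition in_range (u : seq nat) : bool := all (fun l => l./2 < n)%N u.

Lemma eval_extend_gen w :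
  eval extend_gen (letters (@nat_of_ord n) w) = word_value s w.
Proof.
rewrite eval_letters; apply: eq_bigr => -[i b] _ /=.
by rewrite /extend_gen valK.
Qed.

Lemma in_range_letters u :
  reflect (exists w, letters (@nat_of_ord n) w = u) (in_range u).
Proof.
apply: (iffP idP) => [|[w <-]]; last first.
  by apply/allP => l /mapP[[i b] _ ->]; have := ltn_ord i; rewrite /=; lia.
elim: u => [_|l u IHu /= /andP[ltl /IHu[w <-]]]; first by exists [::].
exists ((Ordinal ltl, odd l) :: w); rewrite /letters /=; congr cons.
by rewrite addnC odd_double_half.
Qed.

(** Every number codes a word over [s], once letters out of range are dropped.
    The words accepted by the membership test enumerate the subgroup, and a word
    in the elements of this enumeration unfolds to a word over [s]. *)
Lemma restricted_computable_order :
  computable_order k (fun x y : H => leG (phi x) (phi y)).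
Proof.
split; first exact: restricted_order.
have [le leP leE] := recursive_word_pairsE leC.
have [mem memP memE] := recursive_wordsE memC.
have {}leE u v : in_range u -> in_range v ->
    leG (eval extend_gen u) (eval extend_gen v) <-> le (u, v).
  by move=> /in_range_letters[u' <-] /in_range_letters[v' <-]; rewrite !eval_extend_gen.
have {}memE u : in_range u -> in_image phi (eval extend_gen u) <-> mem u.
  by move=> /in_range_letters[u' <-]; rewrite eval_extend_gen.
pose valid i := [seq l <- CodeSeq.decode i | l./2 < n]%N.
pose member i := if mem (valid i) then valid i else [::].
have valid_in i : in_range (valid i) by apply: filter_all.
have member_in i : in_range (member i) by rewrite /member; case: ifP.
have [x xE] : exists x : nat -> H, forall i, phi (x i) = eval extend_gen (member i).
  suff /choice[x] : forall i, exists h, phi h = eval extend_gen (member i) by exists x.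
  move=> i; rewrite /member; case: ifP => [/memE -/(_ (valid_in i)) //|_].
  by exists 1; rewrite morph1 eval_nil.
pose expand l := if odd l then inv_letters (member l./2) else member l./2.
pose expand_word u := flatten [seq expand l | l <- u].
have expand_in u : in_range (expand_word u).
  elim: u => //= l u IHu; rewrite /expand_word /= /in_range all_cat.
  apply/andP; split=> //; rewrite /expand; case: ifP => _; last exact: member_in.
  rewrite all_rev all_map.
  by apply: sub_all (member_in l./2) => j /=; rewrite half_flip_letter.
have evalE u : phi (eval x u) = eval extend_gen (expand_word u).
  elim: u => [|l u IHu]; first by rewrite !eval_nil morph1.
  rewrite eval_cons gmulfM IHu /expand_word /= eval_cat; congr (_ * _).
  by rewrite /expand /eval_letter; case: ifP => _; rewrite ?eval_inv ?morphV xE.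
right; exists x; split.
  move=> h; have [w sw] := s_gen (phi h).
  have w_in : in_range (letters (@nat_of_ord n) w) by apply/in_range_letters; exists w.
  exists [:: (CodeSeq.code (letters (@nat_of_ord n) w), false)].
  rewrite /word_value big_seq1; apply: phi_inj; rewrite xE /member /valid.
  rewrite CodeSeq.codeK (all_filterP w_in) ifT ?eval_extend_gen //.
  by apply/memE => //; rewrite eval_extend_gen sw; exists h.
apply: (recursive_word_pairsI (p := fun p => le (expand_word p.1, expand_word p.2))).
  have memberC : computable member.
    have validC : computable valid.
      apply: (computable_filter (p := fun q => (q.1./2 < n)%N)).
        exact: computable_decode computable_id.
      by computable_tac.
    apply: computable_if => //; first exact: computable_comp memP validC.
    exact: computable_const.
  have expandC : computable (fun q : nat * seq nat => expand q.1).
    have halfC : computable (fun q : nat * seq nat => member q.1./2).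
      by apply: (computable_comp memberC); computable_tac.
    by apply: computable_if => //; [computable_tac | apply: computable_inv].
  have wordC : computable expand_word.
    by apply: (computable_flatten_map (h := fun q => expand q.1)) => //;
       apply: computable_id.
  by apply: (computable_comp leP); apply: computable_pair;
     apply: (computable_comp wordC); computable_tac.
move=> u v; rewrite -leE ?expand_in // -!evalE.
by rewrite !eval_letters.
Qed.

End Subgroup.

Theorem corollary4 (k : order_kind) (H : groupType)
    (countable_H : exists c : H -> nat, injective c) :
  [/\ has_computable_order k H <->
        (exists (G : groupType) (phi : {multiplicative H -> G}) (leG : rel G),
           computable_overgroup k phi leG),
      has_computable_order k H <->
        (exists (G : groupType) (phi : {multiplicative H -> G}) (leG : rel G),
           computable_overgroup k phi leG /\ subnormal (in_image phi))
    & forall leH : rel H, computable_order k leH ->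
        exists (G : groupType) (phi : {multiplicative H -> G}) (leG : rel G),
          [/\ computable_overgroup k phi leG,
              subnormal (in_image phi)
            & forall x y : H, leG (phi x) (phi y) = leH x y]].
Proof.
have down : (exists (G : groupType) (phi : {multiplicative H -> G}) (leG : rel G),
    computable_overgroup k phi leG) -> has_computable_order k H.
  move=> [G [phi [leG [phi_inj leO [n [s [s_gen leC memC]]]]]]].
  by exists (fun x y => leG (phi x) (phi y)); apply: restricted_computable_order memC.
split; last exact: computable_order_overgroup.
- split=> // -[leH /computable_order_overgroup[G [phi [leG [GC _ _]]]]].
  by exists G, phi, leG.
split=> [[leH /computable_order_overgroup[G [phi [leG [GC sub _]]]]]|].
  by exists G, phi, leG.
by case=> G [phi [leG [GC _]]]; apply: down; exists G, phi, leG.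
Qed.
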